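(* Let $A$ be an MV-algebra and let $s:A\to[0,1]$ be a state on $A$. Then there exist an $L$-space $(X,\Omega,\mu)$ and a homomorphism of MV-algebras $F_A:A\to L_1(\mu)_u$ such that $s(a)=\int F_A(a)\,d\mu$ for every $a\in A$. If $s$ is faithful, then $F_A$ is an embedding (i.e. injective).
   Context: An MV-algebra is a structure $(A,\oplus,{}^*,0)$ such that $(A,\oplus,0)$ is a commutative monoid, $a^{**}=a$, $a\oplus 0^*=0^*$ and $(a^*\oplus b)^*\oplus b=(b^*\oplus a)^*\oplus a$ for all $a,b$. Put $1=0^*$ and $a\odot b=(a^*\oplus b^* )^*$; the lattice order is $a\le b$ iff $a\odot b^*=0$. The partial sum $a+b$ is defined iff $a\le b^*$, and then $a+b=a\oplus b$. A state on $A$ is a map $s:A\to[0,1]$ with $s(1)=1$ and $s(a+b)=s(a)+s(b)$ whenever $a\le b^*$. It is faithful if $s(a)=0$ implies $a=0$. For a measure space $(X,\Omega,\mu)$, $L_1(\mu)_u=\{f\in L_1(\mu)\mid \mathbf 0\le f\le\mathbf 1\}$ (functions modulo a.e. equality), which is an MV-algebra with $f\oplus g=\min(f+g,\mathbf 1)$, $f^*=\mathbf 1-f$. An $L$-space is a measure space $(X,\Omega,\mu)$ that is a probability space and such that $X$ is an extremally disconnected compact Hausdorff space, $\Omega$ is the Borel $\sigma$-algebra of $X$ and $\mu$ is a finite topological measure (i.e. a finite measure for which all open sets are measurable). *)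

(* Defs.v *)
From HB Require Import structures.
From mathcomp Require Import all_boot all_order all_algebra.
From mathcomp Require Import all_classical all_reals all_analysis.
From mathcomp Require Import measurable_realfun lra.

Set Implicit Arguments.
Unset Strict Implicit.
Unset Printing Implicit Defensive.

Import Order.TTheory GRing.Theory Num.Theory.
Import numFieldNormedType.Exports.

Local Open Scope classical_set_scope.
Local Open Scope ring_scope.

HB.mixin Record isMVAlgebra (A : Type) := {
  mvzero : A;
  mvadd : A -> A -> A;
  mvneg : A -> A;
  mvaddA : associative mvadd;
  mvaddC : commutative mvadd;
  mvaddx0 : right_id mvzero mvadd;
  mvnegK : involutive mvneg;
  mvaddx1 : forall a, mvadd a (mvneg mvzero) = mvneg mvzero;
  mvneg_addC : forall a b,
    mvadd (mvneg (mvadd (mvneg a) b)) b = mvadd (mvneg (mvadd (mvneg b) a)) a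
}.

#[short(type="mvalgType")]
HB.structure Definition MVAlgebra := {A of isMVAlgebra A}.

Declare Scope mv_scope.
Delimit Scope mv_scope with MV.
Notation "0" := mvzero : mv_scope.
Notation "a ⊕ b" := (mvadd a b) (at level 50, left associativity) : mv_scope.
Notation "a ^*" := (mvneg a) : mv_scope.
Notation "1" := (mvneg mvzero) : mv_scope.

Definition mvmul (A : mvalgType) (a b : A) : A := ((a^* ⊕ b^*)^*)%MV.
Notation "a ⊙ b" := (mvmul a b) (at level 40, left associativity) : mv_scope.

Definition mvle (A : mvalgType) (a b : A) : Prop := (a ⊙ b^* = 0)%MV.
Notation "a <= b" := (mvle a b) : mv_scope.

Definition mv_morphism (A B : mvalgType) (F : A -> B) : Prop :=
  [/\ F 0%MV = 0%MV,
      forall a b : A, F (a ⊕ b)%MV = (F a ⊕ F b)%MV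
    & forall a : A, F (a^*)%MV = ((F a)^*)%MV].

(* The partial sum a + b is a ⊕ b, defined when a <= b^*. *)
Definition mv_state (R : realType) (A : mvalgType) (s : A -> R) : Prop :=
  [/\ forall a, 0 <= s a <= 1,
      s 1%MV = 1
    & forall a b : A, (a <= b^*)%MV -> s (a ⊕ b)%MV = s a + s b].

Definition mv_faithful (R : realType) (A : mvalgType) (s : A -> R) : Prop :=
  forall a : A, s a = 0 -> a = 0%MV.

Section aeEqMfun_lemmas.
Context d1 d2 (T1 : measurableType d1) (T2 : measurableType d2) (R : realType).
Variable mu : {measure set T1 -> \bar R}.

Lemma aeEqMfun_eq (f g : {mfun_ mu, T1 >-> T2}) : f = g %[ae mu] -> f = g.
Proof.
by move=> fg; apply/eqP; rewrite -[f]reprK -[g]reprK eqmodE; exact/asboolP.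
Qed.

Lemma aeEqMfun_piE (u : {mfun T1 >-> T2}) :
  (\pi_({mfun_ mu, T1 >-> T2}) u : {mfun_ mu, T1 >-> T2})%qT = u %[ae mu].
Proof.
suff: ae_eq_op mu (repr (\pi_({mfun_ mu, T1 >-> T2}) u)%qT) u by move/asboolP.
by rewrite -eqmodE; apply/eqP; rewrite reprK.
Qed.

End aeEqMfun_lemmas.

(* Elements of L_1(mu) are classes modulo a.e. equality; such a class coerces
   to one of its representatives.  The measure is finite, so that the constant
   function 1 is integrable. *)
Record unitL1 d (T : measurableType d) (R : realType)
    (mu : {finite_measure set T -> \bar R}) := UnitL1 {
  unitL1_val : LspaceType mu (@lexx _ _ 1%E) ;
  unitL1_bound : \forall x \ae mu, 0 <= (unitL1_val x : R) <= 1
}.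

Definition unitL1_fun d (T : measurableType d) (R : realType)
  (mu : {finite_measure set T -> \bar R}) (f : unitL1 mu) : T -> R :=
  unitL1_val f.
Coercion unitL1_fun : unitL1 >-> Funclass.

Section unitL1_mvalgebra.
Context d (T : measurableType d) (R : realType).
Variable mu : {finite_measure set T -> \bar R}.
Implicit Types f g h : unitL1 mu.

Lemma unitL1_eq f g : f = g %[ae mu] -> f = g.
Proof.
move=> fg.
have : unitL1_val f = unitL1_val g :> {mfun_ mu, T >-> measurableTypeR R}.
  exact: aeEqMfun_eq.
case: f {fg} => [[f [[cf]]] bf]; case: g => [[g [[cg]]] bg] /= fg.
subst g; have ce : cg = cf by exact: Prop_irrelevance.
by subst cg; have -> : bg = bf by exact: Prop_irrelevance.
Qed.

Lemma measurable_unitL1 f : measurable_fun [set: T] (f : T -> R).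
Proof.
pose v : {mfun_ mu, T >-> measurableTypeR R} := unitL1_val f.
exact: (@measurable_funPT _ _ _ _ (repr v)).
Qed.

Lemma unitL1_01 f : \forall x \ae mu, 0 <= f x <= 1.
Proof. exact: unitL1_bound. Qed.

Section class_of_function.
Variables (u : T -> R) (u_measurable : measurable_fun [set: T] u)
  (u01 : \forall x \ae mu, 0 <= u x <= 1).

Let u_mfun : {mfun T >-> measurableTypeR R} :=
  HB.pack_for {mfun T >-> measurableTypeR R} u
    (isMeasurableFun.Build _ _ T (measurableTypeR R) u
      u_measurable).

Let u_class : {mfun_ mu, T >-> measurableTypeR R} :=
  (\pi_({mfun_ mu, T >-> measurableTypeR R}) u_mfun)%qT.

Let u_classE : u_class = u %[ae mu].
Proof. exact: aeEqMfun_piE. Qed.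

Let u_class_bound : \forall x \ae mu, 0 <= (u_class x : R) <= 1.
Proof. by apply: filterS2 u01 u_classE => x ux ->. Qed.

Let u_class_finite : finite_norm mu 1 u_class.
Proof.
have mc : measurable_fun [set: T] (u_class : T -> R).
  exact: (@measurable_funPT _ _ _ _ (repr u_class)).
rewrite /finite_norm Lnorm1.
apply: (@le_lt_trans _ _ (\int[mu]_x (cst 1%E x))%E).
  apply: ae_ge0_le_integral => //.
  - apply: (@measurableT_comp _ _ _ _ _ _ abse _ (EFin \o u_class)) => //.
    exact/measurable_EFinP.
  - move: u_class_bound; apply: filterS => x /andP[c0 c1] _ /=.
    by rewrite lee_fin ger0_norm.
by rewrite integral_cst// mul1e ltey_eq fin_num_measure.
Qed.

Definition unitL1_of : unitL1 mu :=
  @UnitL1 _ _ _ mu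
    (HB.pack_for (LspaceType mu (@lexx _ _ 1%E)) u_class
       (isFinLebesgue.Build d T R mu 1%E (lexx _) u_class u_class_finite))
    u_class_bound.

Lemma unitL1_ofE : unitL1_of = u %[ae mu].
Proof. exact: u_classE. Qed.

End class_of_function.

Let zero_measurable : measurable_fun [set: T] (cst 0 : T -> R).
Proof. exact: measurable_cst. Qed.

Let zero_bound : \forall x \ae mu, 0 <= (cst 0 : T -> R) x <= 1.
Proof. by apply: aeW => x /=; rewrite lexx ler01. Qed.

Let add_measurable f g :
  measurable_fun [set: T] (fun x => Num.min (f x + g x) 1 : R).
Proof.
apply: measurable_minr => //.
by apply: measurable_funD; exact: measurable_unitL1.
Qed.

Let add_bound f g : \forall x \ae mu, 0 <= Num.min (f x + g x) 1 <= 1.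
Proof.
apply: filterS2 (unitL1_01 f) (unitL1_01 g).
move=> x /andP[f0 f1] /andP[g0 g1].
by case: (leP (f x + g x) 1) => ?; apply/andP; split; lra.
Qed.

Let neg_measurable f : measurable_fun [set: T] (fun x => 1 - f x : R).
Proof. by apply: measurable_funB => //; exact: measurable_unitL1. Qed.

Let neg_bound f : \forall x \ae mu, 0 <= 1 - f x <= 1.
Proof. by apply: filterS (unitL1_01 f) => x /andP[? ?]; apply/andP; split; lra. Qed.

Definition unitL1_zero : unitL1 mu := unitL1_of zero_measurable zero_bound.
Definition unitL1_add f g : unitL1 mu :=
  unitL1_of (add_measurable f g) (add_bound f g).
Definition unitL1_neg f : unitL1 mu := unitL1_of (neg_measurable f) (neg_bound f).

Lemma unitL1_zeroE : \forall x \ae mu, unitL1_zero x = 0.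
Proof. by apply: filterS (unitL1_ofE zero_measurable zero_bound) => x; exact. Qed.

Lemma unitL1_addE f g :
  \forall x \ae mu, unitL1_add f g x = Num.min (f x + g x) 1.
Proof. by apply: filterS (unitL1_ofE (add_measurable f g) (add_bound f g)) => x; exact. Qed.

Lemma unitL1_negE f : \forall x \ae mu, unitL1_neg f x = 1 - f x.
Proof. by apply: filterS (unitL1_ofE (neg_measurable f) (neg_bound f)) => x; exact. Qed.

Let addA : associative unitL1_add.
Proof.
move=> f g h; apply: unitL1_eq.
apply: filter_app (unitL1_addE f (unitL1_add g h)).
apply: filter_app (unitL1_addE (unitL1_add f g) h).
apply: filter_app (unitL1_addE f g); apply: filter_app (unitL1_addE g h).
apply: filterS3 (unitL1_01 f) (unitL1_01 g) (unitL1_01 h).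
move=> x /andP[f0 f1] /andP[g0 g1] /andP[h0 h1] gh fg fg_h f_gh _.
rewrite f_gh fg_h gh fg.
by case: (leP (f x + g x) 1) => ?; case: (leP (g x + h x) 1) => ?;
  case: (leP (f x + _) 1) => ?; case: (leP (_ + h x) 1) => ?; lra.
Qed.

Let addC : commutative unitL1_add.
Proof.
move=> f g; apply: unitL1_eq.
by apply: filterS2 (unitL1_addE f g) (unitL1_addE g f) => x -> -> _; rewrite addrC.
Qed.

Let addx0 : right_id unitL1_zero unitL1_add.
Proof.
move=> f; apply: unitL1_eq.
apply: filterS3 (unitL1_addE f unitL1_zero) unitL1_zeroE (unitL1_01 f).
by move=> x -> -> /andP[_ f1] _; rewrite addr0 min_l.
Qed.

Let negK : involutive unitL1_neg.
Proof.
move=> f; apply: unitL1_eq.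
apply: filterS2 (unitL1_negE (unitL1_neg f)) (unitL1_negE f) => x -> -> _.
by rewrite subKr.
Qed.

Let addx1 f : unitL1_add f (unitL1_neg unitL1_zero) = unitL1_neg unitL1_zero.
Proof.
apply: unitL1_eq.
apply: filter_app (unitL1_addE f (unitL1_neg unitL1_zero)).
apply: filterS3 (unitL1_negE unitL1_zero) unitL1_zeroE (unitL1_01 f).
move=> x n0 z0 /andP[f0 _] -> _.
by rewrite n0 z0 subr0 min_r// lerDr.
Qed.

Let neg_addE f g : \forall x \ae mu,
  unitL1_add (unitL1_neg (unitL1_add (unitL1_neg f) g)) g x = Num.max (f x) (g x).
Proof.
apply: filter_app (unitL1_addE (unitL1_neg (unitL1_add (unitL1_neg f) g)) g).
apply: filter_app (unitL1_negE (unitL1_add (unitL1_neg f) g)).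
apply: filter_app (unitL1_addE (unitL1_neg f) g).
apply: filterS3 (unitL1_negE f) (unitL1_01 f) (unitL1_01 g).
move=> x nf /andP[f0 f1] /andP[g0 g1] nfg nnfg ->; rewrite nnfg nfg nf.
by case: (leP (f x) (g x)) => ?; case: (leP (1 - f x + g x) 1) => ?;
  case: leP => ?; lra.
Qed.

Let neg_addC f g :
  unitL1_add (unitL1_neg (unitL1_add (unitL1_neg f) g)) g =
  unitL1_add (unitL1_neg (unitL1_add (unitL1_neg g) f)) f.
Proof.
apply: unitL1_eq.
by apply: filterS2 (neg_addE f g) (neg_addE g f) => x -> -> _; rewrite maxC.
Qed.

HB.instance Definition _ := isMVAlgebra.Build (unitL1 mu)
  addA addC addx0 negK addx1 neg_addC.

End unitL1_mvalgebra.

Definition extremally_disconnected (X : topologicalType) : Prop :=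
  forall U : set X, open U -> open (closure U).

Definition borel (X : ptopologicalType) := g_sigma_algebraType (@open X).

Lemma open_measurable_borel (X : ptopologicalType) (U : set X) :
  open U -> measurable (U : set (borel X)).
Proof. exact: sub_gen_smallest. Qed.

(* Measurable types are pointed in the library; a probability space is nonempty,
   so this is no restriction.  By open_measurable_borel every Borel measure is
   topological, and a probability is a finite measure. *)
Record L_space (R : realType) := LSpace {
  Lsp_top :> ptopologicalType ;
  Lsp_mu : probability (borel Lsp_top) R ;
  Lsp_compact : compact [set: Lsp_top] ;
  Lsp_hausdorff : hausdorff_space Lsp_top ;
  Lsp_extremally_disconnected : extremally_disconnected Lsp_top
}.

(* Main.v *)
From HB Require Import structures.
Require Import Defs.
From mathcomp Require Import all_boot all_order all_algebra.
From mathcomp Require Import all_classical all_reals all_analysis.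
From mathcomp Require Import measurable_realfun ring lra.

(** A state is an average of homomorphisms into [[0, 1]], and the average can be
    realized by a Borel probability on a Stone-Cech compactification.

    An extreme state [t] is a homomorphism. For an element [b] the part of [t]
    carried by [b], that is [x |-> sup_n t(x ^ n b)], is additive and below [t], and
    extremality makes it a multiple of [t]. Hence of two disjoint elements at least
    one is null for [t], so that [t] preserves meets and then truncated sums
    ([extreme_state_hom]).

    A minimal face of the functionals below a sublinear one is a point
    ([extreme_hahn_banach]). Applied to the supremum over all states, this says that
    a linear combination of evaluations which is nonnegative at every homomorphism
    is nonnegative at every state ([lincomb_ge0_of_hom]). So the infimum
    of the values at [s] of the combinations above [f] defines a finite sublinear
    functional of the bounded function [f] on the set [Y] of the homomorphisms, and a
    linear functional below it is a finitely additive expectation [L] on [Y] with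
    [L (h |-> h a) = s a] ([state_is_mean]).

    The space [X] of all ultrafilters on [Y] is compact, Hausdorff and extremally
    disconnected, and the subsets of [Y] are its clopen sets. On them [L] is finitely
    additive; approximating open sets from inside by clopen sets and arbitrary sets
    from outside by open sets gives, by compactness, an outer measure for which open
    sets are measurable, hence a Borel probability [mu]
    ([mean_borel_probability]). Bounded functions on [Y] extend to [X] by limits
    along ultrafilters, and the integral of the extension is the value of [L]
    ([Rintegral_sc_ext]).

    Finally [F a] is the class of the extension of [h |-> h a]. Limits along
    ultrafilters commute with the operations, so [F] is a homomorphism, and its
    integral is [s a]. If [s] is faithful, [F a = 0] gives [s a = 0] and [a = 0]. *)

Set Implicit Arguments.
Unset Strict Implicit.
Unset Printing Implicit Defensive.

Import Order.TTheory GRing.Theory Num.Theory.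
Import numFieldNormedType.Exports.

Local Open Scope classical_set_scope.
Local Open Scope ring_scope.

(** * Arithmetic of MV-algebras *)

Section mv_arithmetic.
Context {A : mvalgType}.
Implicit Types a b c d x y z : A.
Local Open Scope mv_scope.

Definition mvsub a b : A := (a^* ⊕ b)^*.
Definition mvmeet a b : A := mvsub a (mvsub a b).
Definition mvnat (n : nat) a : A := iter n (mvadd a) 0.

Lemma mvadd0x a : 0 ⊕ a = a.
Proof. by rewrite mvaddC mvaddx0. Qed.

Lemma mvadd1x a : 1 ⊕ a = 1.
Proof. by rewrite mvaddC mvaddx1. Qed.

Lemma mvadd_negx a : a^* ⊕ a = 1.
Proof.
have := mvneg_addC a 1.
by rewrite mvaddx1 mvnegK mvadd0x => <-.
Qed.

Lemma mvleE a b : a <= b <-> a^* ⊕ b = 1.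
Proof.
rewrite /mvle /mvmul mvnegK; split=> [e|->]; last by rewrite mvnegK.
by rewrite -[LHS]mvnegK e.
Qed.

Lemma mvlexx a : a <= a.
Proof. by apply/mvleE; rewrite mvadd_negx. Qed.

Lemma mvle0x a : 0 <= a.
Proof. by apply/mvleE; rewrite mvadd1x. Qed.

Lemma mvle_addr a b : a <= a ⊕ b.
Proof. by apply/mvleE; rewrite mvaddA mvadd_negx mvadd1x. Qed.

Lemma mvsubK a b : a <= b -> mvsub b a ⊕ a = b.
Proof. by move/mvleE=> e; rewrite /mvsub mvneg_addC e mvnegK mvadd0x. Qed.

Lemma mvle_anti a b : a <= b -> b <= a -> a = b.
Proof.
by move=> /mvsubK ab /mvleE ba; rewrite -ab /mvsub ba mvnegK mvadd0x.
Qed.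

Lemma mvle_trans b a c : a <= b -> b <= c -> a <= c.
Proof.
move=> /mvsubK <- /mvsubK <-; rewrite [_ ⊕ a]mvaddC mvaddC -mvaddA.
exact: mvle_addr.
Qed.

Lemma mvle_neg a b : a <= b -> b^* <= a^*.
Proof. by move/mvleE=> e; apply/mvleE; rewrite mvnegK mvaddC. Qed.

Lemma mvle_add a b c d : a <= b -> c <= d -> a ⊕ c <= b ⊕ d.
Proof.
move=> /mvsubK <- /mvsubK <-.
have -> : mvsub b a ⊕ a ⊕ (mvsub d c ⊕ c) = a ⊕ c ⊕ (mvsub b a ⊕ mvsub d c).
  rewrite [mvsub b a ⊕ a]mvaddC [mvsub d c ⊕ c]mvaddC -!mvaddA; congr (_ ⊕ _).
  by rewrite !mvaddA; congr (_ ⊕ _); rewrite mvaddC.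
exact: mvle_addr.
Qed.

(** Residuation: truncated subtraction is left adjoint to addition. *)
Lemma mvle_subl a b c : mvsub a b <= c <-> a <= b ⊕ c.
Proof. by split=> /mvleE e; apply/mvleE; move: e; rewrite /mvsub mvnegK mvaddA. Qed.

Lemma mvsub_le a b : mvsub a b <= a.
Proof. by apply/mvle_subl; rewrite mvaddC; exact: mvle_addr. Qed.

Lemma mvsub_neg a b : mvsub a b = mvsub b^* a^*.
Proof. by rewrite /mvsub mvnegK mvaddC. Qed.

Lemma mvsub_le_neg a b : mvsub a b <= b^*.
Proof. by rewrite mvsub_neg; exact: mvsub_le. Qed.

Lemma mvsub_anti a b c : a <= b -> mvsub c b <= mvsub c a.
Proof. by move=> ab; apply/mvle_neg/mvle_add => //; exact: mvlexx. Qed.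

Lemma mvmeetE a b : mvmeet a b = ((b ⊕ a^*)^* ⊕ a^*)^*.
Proof. by rewrite /mvmeet /mvsub mvaddC [a^* ⊕ b]mvaddC. Qed.

Lemma mvmeetC a b : mvmeet a b = mvmeet b a.
Proof.
rewrite !mvmeetE; congr (_^*); move: (mvneg_addC b^* a^*).
by rewrite !mvnegK.
Qed.

Lemma mvmeet_lel a b : mvmeet a b <= a.
Proof. exact: mvsub_le. Qed.

Lemma mvmeet_ler a b : mvmeet a b <= b.
Proof. by rewrite mvmeetC; exact: mvmeet_lel. Qed.

Lemma mvmeet_id a b : a <= b -> mvmeet a b = a.
Proof.
by move=> /mvleE ab; rewrite /mvmeet /mvsub ab mvnegK mvaddx0 mvnegK.
Qed.

Lemma mvmeet_mono a b c : a <= b -> mvmeet a c <= mvmeet b c.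
Proof.
by move=> ab; rewrite 2!(mvmeetC _ c); apply/mvsub_anti/mvsub_anti.
Qed.

Lemma mvle_meet a b c : c <= a -> c <= b -> c <= mvmeet a b.
Proof.
by move=> ca cb; rewrite -(mvmeet_id cb); exact: mvmeet_mono.
Qed.

(** Immediate from residuation: a lower bound of [a ⊕ b] and [a ⊕ c] is, after
    subtracting [a], a lower bound of [b] and [c]. *)
Lemma mvle_add_meet a b c z : z <= a ⊕ b -> z <= a ⊕ c -> z <= a ⊕ mvmeet b c.
Proof. by move=> /mvle_subl zb /mvle_subl zc; apply/mvle_subl/mvle_meet. Qed.

(** Distributing [⊕] over the meets on the right gives the four summands [x ⊕ y],
    [x ⊕ c], [c ⊕ y] and [c ⊕ c], each of which lies above the left-hand side. *)
Lemma mvmeet_add x y c : mvmeet (x ⊕ y) c <= mvmeet x c ⊕ mvmeet y c.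
Proof.
have [zxy zc] : mvmeet (x ⊕ y) c <= x ⊕ y /\ mvmeet (x ⊕ y) c <= c.
  by split; [exact: mvmeet_lel|exact: mvmeet_ler].
move: (mvmeet _ _) zxy zc => z zxy zc.
have ctop u : z <= u ⊕ c.
  by apply: mvle_trans zc _; rewrite mvaddC; exact: mvle_addr.
apply: mvle_add_meet; last exact: ctop.
rewrite mvaddC; apply: mvle_add_meet; first by rewrite mvaddC.
exact: ctop.
Qed.

(** With [m] the meet one has [a = m ⊕ (a - b)] and [b = m ⊕ (b - a)]; a common
    lower bound [z] of the two differences gives [m ⊕ z <= m], an orthogonal sum,
    whence [z = 0]. *)
Lemma mvmeet_sub a b : mvmeet (mvsub a b) (mvsub b a) = 0.
Proof.
set m := mvmeet a b; set z := mvmeet _ _.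
have zm : mvmeet m^* z = z.
  rewrite mvmeetC; apply: mvmeet_id; apply: mvle_trans (mvmeet_lel _ _) _.
  apply: mvle_trans (mvsub_le_neg a b) _.
  by apply: mvle_neg; exact: mvmeet_ler.
have mza : m ⊕ z <= a.
  rewrite -[X in _ <= X](mvsubK (mvsub_le a b)).
  by apply: mvle_add; [exact: mvlexx|exact: mvmeet_lel].
have mzb : m ⊕ z <= b.
  rewrite -[X in _ <= X](mvsubK (mvsub_le b a)).
  by apply: mvle_add; [rewrite /m mvmeetC; exact: mvlexx|exact: mvmeet_ler].
have mzm : (m ⊕ z)^* ⊕ m = 1 by apply/mvleE/mvle_meet.
rewrite -zm mvmeetE mvnegK [z ⊕ m]mvaddC.
by rewrite mzm mvnegK.
Qed.

Lemma mvnatD n m a : mvnat (n + m) a = mvnat n a ⊕ mvnat m a.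
Proof.
by elim: n => [|n IH]; rewrite ?mvadd0x//= /mvnat/= -/(mvnat _ _) IH mvaddA.
Qed.

Lemma mvmeet_nat0 a b n : mvmeet a b = 0 -> mvmeet a (mvnat n b) = 0.
Proof.
have mvle_0 z : z <= 0 -> z = 0 by move=> z0; apply: mvle_anti z0 (mvle0x z).
move=> ab0; elim: n => [|n IH]; first exact/mvle_0/mvmeet_ler.
apply: mvle_0; rewrite mvmeetC; apply: mvle_trans (mvmeet_add _ _ _) _.
by rewrite mvmeetC ab0 mvmeetC IH mvaddx0; exact: mvlexx.
Qed.

End mv_arithmetic.

(** * States, and extreme states as homomorphisms *)

Section states.
Context {R : realType} {A : mvalgType}.
Implicit Types (a b x y : A) (s t : A -> R).

Definition extreme_state t : Prop :=
  mv_state t /\ forall t1 t2, mv_state t1 -> mv_state t2 ->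
    (forall a, t1 a + t2 a = 2 * t a) -> forall a, t1 a = t a.

(** The homomorphisms into the unit interval [[0, 1]] with truncated addition. *)
Definition unit_hom t : Prop :=
  mv_state t /\ forall a b, t (a ⊕ b)%MV = Num.min (t a + t b) 1.

(** The part of [t] carried by [b]: it vanishes on what is disjoint from [b] and
    agrees with [t] below [b]. *)
Definition state_part t b x : R := sup [set t (mvmeet x (mvnat n b)) | n in [set: nat]].

Section one_state.
Context {t : A -> R} (t_state : mv_state t).

Let tD a b : (a <= b^*)%MV -> t (a ⊕ b)%MV = t a + t b.
Proof. by case: t_state => _ _; exact. Qed.

Lemma state_ge0 a : 0 <= t a.
Proof. by case: t_state => /(_ a)/andP[]. Qed.

Lemma state_neg a : t (a^*)%MV = 1 - t a.
Proof.
have [_ t1 _] := t_state.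
by rewrite -t1 -(mvadd_negx a) tD ?addrK//; exact: mvlexx.
Qed.

Lemma state0 : t 0%MV = 0.
Proof. by have [_ t1 _] := t_state; rewrite -(mvnegK mvzero) state_neg t1 subrr. Qed.

Lemma state_sub a b : (a <= b)%MV -> t b = t (mvsub b a) + t a.
Proof. by move=> /mvsubK {1}<-; rewrite tD//; exact: mvsub_le_neg. Qed.

Lemma state_le a b : (a <= b)%MV -> t a <= t b.
Proof. by move=> /state_sub ->; rewrite lerDr state_ge0. Qed.

Lemma state_meet a b : t a = t (mvmeet a b) + t (mvsub a b).
Proof. by rewrite (state_sub (mvsub_le a b)). Qed.

Lemma state_add a b : t (a ⊕ b)%MV = t a + t (mvmeet b a^*%MV).
Proof.
rewrite (state_sub (mvle_addr a b)) addrC mvmeetC mvmeetE mvnegK.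
by rewrite /mvsub [(b ⊕ a)%MV]mvaddC.
Qed.

Let part_has_sup b x : has_sup [set t (mvmeet x (mvnat n b)) | n in [set: nat]].
Proof.
split; first by exists (t (mvmeet x (mvnat 0 b))), 0%N.
by exists (t x) => _ [n _ <-]; apply/state_le/mvmeet_lel.
Qed.

Lemma state_part_ub b x n : t (mvmeet x (mvnat n b)) <= state_part t b x.
Proof. by apply: ub_le_sup; [exact: (part_has_sup b x).2|exists n]. Qed.

Lemma state_part_le_of b x (r : R) :
  (forall n, t (mvmeet x (mvnat n b)) <= r) -> state_part t b x <= r.
Proof. by move=> h; apply: ge_sup; [exact: (part_has_sup b x).1|move=> _ [n _ <-]]. Qed.

Lemma state_part_ge0 b x : 0 <= state_part t b x.
Proof. exact: le_trans (state_ge0 _) (state_part_ub b x 0). Qed.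

Lemma state_part_le b x : state_part t b x <= t x.
Proof. by apply: state_part_le_of => n; apply/state_le/mvmeet_lel. Qed.

Lemma state_part_id b : state_part t b b = t b.
Proof.
apply/eqP; rewrite eq_le state_part_le/=; apply: le_trans (state_part_ub b b 1).
by rewrite /mvnat/= mvaddx0 mvmeet_id//; exact: mvlexx.
Qed.

Lemma state_part_disjoint a b : mvmeet a b = 0%MV -> state_part t b a = 0.
Proof.
move=> ab; apply/eqP; rewrite eq_le state_part_ge0 andbT.
by apply: state_part_le_of => n; rewrite mvmeet_nat0// state0.
Qed.

(** Writing [x ^ c] for the meet, [(x ⊕ y) ^ n b <= (x ^ n b) ⊕ (y ^ n b)] gives one
    inequality and [(x ^ n b) ⊕ (y ^ m b) <= (x ⊕ y) ^ (n + m) b] the other. *)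
Lemma state_partD b x y : (x <= y^*)%MV ->
  state_part t b (x ⊕ y)%MV = state_part t b x + state_part t b y.
Proof.
move=> xy.
have orth c d : t (mvmeet x c ⊕ mvmeet y d)%MV = t (mvmeet x c) + t (mvmeet y d).
  apply/tD/(mvle_trans (mvmeet_lel _ _))/(mvle_trans xy)/mvle_neg.
  exact: mvmeet_lel.
apply/eqP; rewrite eq_le; apply/andP; split.
  apply: state_part_le_of => n.
  apply: (le_trans (state_le (mvmeet_add _ _ _))); rewrite orth.
  by apply: lerD; exact: state_part_ub.
rewrite -lerBrDr; apply: state_part_le_of => n.
rewrite lerBrDr addrC -lerBrDr; apply: state_part_le_of => m.
rewrite lerBrDr addrC -orth; apply: le_trans (state_part_ub b _ (n + m)).
apply: state_le; apply: mvle_meet; first by apply: mvle_add; exact: mvmeet_lel.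
by rewrite mvnatD; apply: mvle_add; exact: mvmeet_ler.
Qed.

End one_state.

(** Moving [t] by [±(u - u(1) t)], with [u] the part of [t] carried by [b], gives
    two states with midpoint [t]; extremality therefore forces [u] to be a
    multiple of [t]. *)
Lemma extreme_state_part t b x : extreme_state t ->
  state_part t b x = state_part t b 1%MV * t x.
Proof.
move=> [ht ext]; set u := state_part t b.
have [t01 t1 tD] := ht.
have u0 y : 0 <= u y by exact: state_part_ge0.
have ut y : u y <= t y by exact: state_part_le.
have uD y z : (y <= z^*)%MV -> u (y ⊕ z)%MV = u y + u z by exact: state_partD.
have u1 : u 1%MV <= 1 by rewrite -t1.
have tge0 y : 0 <= t y by exact: state_ge0.
have st v : (forall y, 0 <= v y) -> v 1%MV = 1 ->
    (forall y z, (y <= z^*)%MV -> v (y ⊕ z)%MV = v y + v z) -> mv_state v.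
  move=> v0 v1 vD; split=> // y; rewrite v0/= -v1 -(mvadd_negx y) vD ?lerDr//.
  exact: mvlexx.
have : t x + (u x - u 1%MV * t x) = t x.
  apply: (ext (fun y => t y + (u y - u 1%MV * t y))
              (fun y => t y - (u y - u 1%MV * t y))).
  - apply: st => [y||y z yz].
    + have := u0 y.
      have : 0 <= (1 - u 1%MV) * t y by rewrite mulr_ge0// subr_ge0.
      by rewrite mulrBl mul1r; lra.
    + by rewrite t1; ring.
    + by rewrite uD// tD//; ring.
  - apply: st => [y||y z yz].
    + have := ut y; have : 0 <= u 1%MV * t y by exact: mulr_ge0.
      by lra.
    + by rewrite t1; ring.
    + by rewrite uD// tD//; ring.
  - by move=> y; ring.
by lra.
Qed.

(** If [t b] is not zero, the proportionality of [t] and of its part carried by [b],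
    which agree at [b], makes them equal; and that part vanishes at [a]. *)
Lemma extreme_state_disjoint t a b : extreme_state t -> mvmeet a b = 0%MV ->
  t a = 0 \/ t b = 0.
Proof.
move=> ht ab; have := extreme_state_part b a ht; have := extreme_state_part b b ht.
have st := ht.1.
rewrite (state_part_id st) (state_part_disjoint st ab).
have [->|tb] := eqVneq (t b) 0; first by right.
rewrite -[LHS]mul1r => /(mulIf tb) <-; rewrite mul1r => <-.
by left.
Qed.

(** Since [a - b] and [b - a] are disjoint, one of them is a null element, so [t]
    preserves meets; and [a ⊕ b] is the partial sum of [a] and of the meet of [b]
    with [a^*]. *)
Lemma extreme_state_hom t : extreme_state t -> unit_hom t.
Proof.
move=> ht; have st := ht.1; split=> // a b.
have tmeet x y : t (mvmeet x y) = Num.min (t x) (t y).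
  have := state_meet st x y; have := state_meet st y x; rewrite mvmeetC.
  have := state_ge0 st (mvsub x y); have := state_ge0 st (mvsub y x).
  by have [->|->] := extreme_state_disjoint ht (mvmeet_sub x y);
    case: (leP (t x) (t y)); lra.
rewrite (state_add st) tmeet (state_neg st).
by case: (leP (t b) (1 - t a)); case: (leP (t a + t b) 1); lra.
Qed.

End states.

(** * An extreme form of the Hahn-Banach theorem *)

Section extreme_hahn_banach.
Context {R : realType} {V : lmodType R} (D : set V).
Context (DD : forall x y, D x -> D y -> D (x + y))
  (DZ : forall (c : R) x, D x -> D (c *: x)).
Implicit Types (x y v : V) (p q L : V -> R).

Definition sublinear_on q : Prop :=
  (forall x y, D x -> D y -> q (x + y) <= q x + q y) /\
  (forall (c : R) x, 0 <= c -> D x -> q (c *: x) = c * q x).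

Definition linear_on L : Prop :=
  (forall x y, D x -> D y -> L (x + y) = L x + L y) /\
  (forall (c : R) x, D x -> L (c *: x) = c * L x).

Definition le_on p q : Prop := forall x, D x -> p x <= q x.

(** [p] is the support function of a face of the convex set of the linear
    functionals below [q]. *)
Definition face_of q p : Prop := forall L1 L2,
  linear_on L1 -> linear_on L2 -> le_on L1 q -> le_on L2 q ->
  (forall x, D x -> L1 x + L2 x <= 2 * p x) -> le_on L1 p /\ le_on L2 p.

(** The support function of the face on which the value at [v] is maximal. *)
Definition top_face q v x : R :=
  inf [set q (x + r *: v) - r * q v | r in [set r : R | 0 <= r]].

Section sublinear.
Context {q : V -> R} (q_sub : sublinear_on q).

Lemma sublinearD x y : D x -> D y -> q (x + y) <= q x + q y.
Proof. exact: q_sub.1. Qed.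

Lemma sublinearZ (c : R) x : 0 <= c -> D x -> q (c *: x) = c * q x.
Proof. exact: q_sub.2. Qed.

Lemma D_opp x : D x -> D (- x).
Proof. by rewrite -scaleN1r; exact: DZ. Qed.

Lemma sublinear0 x : D x -> q 0 = 0.
Proof. by move=> Dx; rewrite -(scale0r x) sublinearZ// mul0r. Qed.

Lemma sublinear_opp x : D x -> - q (- x) <= q x.
Proof.
move=> Dx; have := sublinearD Dx (D_opp Dx).
by rewrite subrr (sublinear0 Dx); lra.
Qed.

Context {v : V} (Dv : D v).

Let top_lb x : D x ->
  lbound [set q (x + r *: v) - r * q v | r in [set r : R | 0 <= r]] (- q (- x)).
Proof.
move=> Dx _ [r r0 <-]; have Dxr : D (x + r *: v) by apply: DD => //; exact: DZ.
have := sublinearD (D_opp Dx) Dxr.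
by rewrite addrA addNr add0r sublinearZ//; lra.
Qed.

Lemma top_face_le_at x (r : R) : D x -> 0 <= r ->
  top_face q v x <= q (x + r *: v) - r * q v.
Proof. by move=> Dx r0; apply: ge_inf; [exists (- q (- x)); exact: top_lb|exists r]. Qed.

Lemma le_top_face x (m : R) :
  (forall r : R, 0 <= r -> m <= q (x + r *: v) - r * q v) -> m <= top_face q v x.
Proof.
move=> h; apply: lb_le_inf; last by move=> _ [r r0 <-]; exact: h.
by exists (q (x + 0 *: v) - 0 * q v), 0 => /=.
Qed.

Lemma top_face_le : le_on (top_face q v) q.
Proof.
move=> x Dx; have := top_face_le_at Dx (lexx 0).
by rewrite scale0r addr0 mul0r subr0.
Qed.

Lemma top_face_oppr : top_face q v (- v) <= - q v.
Proof.
have := top_face_le_at (D_opp Dv) ler01.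
by rewrite scale1r addNr (sublinear0 Dv) mul1r sub0r.
Qed.

Lemma top_face_sublinear : sublinear_on (top_face q v).
Proof.
split=> [x y Dx Dy|c x].
  rewrite -lerBlDr; apply: le_top_face => r r0.
  rewrite lerBlDr -lerBlDl; apply: le_top_face => k k0.
  rewrite lerBlDl; have Dxr : D (x + r *: v) by apply: DD => //; exact: DZ.
  have Dyk : D (y + k *: v) by apply: DD => //; exact: DZ.
  have := sublinearD Dxr Dyk; rewrite addrACA -scalerDl.
  have := top_face_le_at (DD Dx Dy) (addr_ge0 r0 k0); rewrite mulrDl.
  by lra.
rewrite le_eqVlt => /predU1P[<- Dx|c0 Dx].
  rewrite scale0r mul0r; apply/eqP; rewrite eq_le; apply/andP; split.
    by have := top_face_le (DZ 0 Dx); rewrite scale0r (sublinear0 Dx).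
  by apply: le_top_face => r r0; rewrite add0r sublinearZ// subrr.
have Zc (r : R) : 0 <= r ->
    q (c *: x + r *: v) - r * q v = c * (q (x + (r / c) *: v) - r / c * q v).
  move=> r0; have rc : c * (r / c) = r by rewrite mulrC divfK// gt_eqF.
  have Dxr : D (x + (r / c) *: v) by apply: DD => //; exact: DZ.
  by rewrite mulrBr -(sublinearZ (ltW c0) Dxr) scalerDr scalerA rc mulrA rc.
apply/eqP; rewrite eq_le; apply/andP; split; last first.
  apply: le_top_face => r r0; rewrite Zc// ler_pM2l//; apply: top_face_le_at => //.
  by rewrite divr_ge0// ltW.
rewrite -ler_pdivrMl//; apply: le_top_face => r r0.
have cr0 : 0 <= c * r by rewrite mulr_ge0// ltW.
have := top_face_le_at (DZ c Dx) cr0.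
by rewrite Zc// [c * r]mulrC mulfK ?gt_eqF// ler_pdivrMl.
Qed.

(** Evaluating the hypothesis at [- v] shows that the values of both functionals at
    [v] are the largest possible one. *)
Lemma top_face_face : face_of q (top_face q v).
Proof.
move=> L1 L2 [L1D L1Z] [L2D L2Z] L1q L2q L12.
have := L12 _ (D_opp Dv); rewrite -scaleN1r L1Z// L2Z// scaleN1r => L12v.
have := top_face_oppr; have := L1q _ Dv; have := L2q _ Dv => q2 q1 qN.
have [e1 e2] : L1 v = q v /\ L2 v = q v by lra.
have below L : linear_on L -> le_on L q -> L v = q v -> le_on L (top_face q v).
  move=> [LD LZ] Lq Lv x Dx; apply: le_top_face => r r0.
  have Drv : D (r *: v) by exact: DZ.
  by have := Lq _ (DD Dx Drv); rewrite LD// LZ// Lv; lra.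
by split; apply: below.
Qed.

End sublinear.

(** A face whose support function coincides with all its own top faces is a single
    functional, since then [p (- v) <= - p v]. *)
Lemma linear_of_top_face p : sublinear_on p ->
  (forall v, D v -> le_on p (top_face p v)) -> linear_on p.
Proof.
move=> psub ptop.
have pN x : D x -> p (- x) = - p x.
  move=> Dx; apply/eqP; rewrite eq_le; apply/andP; split.
    exact: le_trans (ptop x Dx _ (D_opp Dx)) (top_face_oppr psub Dx).
  by have := sublinear_opp psub Dx; lra.
split=> [x y Dx Dy|c x Dx].
  apply/eqP; rewrite eq_le sublinearD//=.
  have := sublinearD psub (DD Dx Dy) (D_opp Dy).
  by rewrite addrK pN//; lra.
have [c0|/ltW c0] := leP 0 c; first exact: (sublinearZ psub).
rewrite -[X in p (X *: _)]opprK scaleNr pN; last exact: DZ.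
by rewrite (sublinearZ psub) ?oppr_ge0// mulNr opprK.
Qed.

(** The value at [v0] is maximized by an extreme linear functional below [q]: a
    minimal face of the face on which this value is maximal is a single point. *)
Theorem extreme_hahn_banach q v0 : sublinear_on q -> D v0 ->
  exists L, [/\ linear_on L, le_on L q, L v0 = q v0 &
    forall L1 L2, linear_on L1 -> linear_on L2 -> le_on L1 q -> le_on L2 q ->
      (forall x, D x -> L1 x + L2 x = 2 * L x) -> forall x, D x -> L1 x = L x].
Proof.
move=> qsub Dv0; pose p0 := top_face q v0.
have p0sub : sublinear_on p0 by exact: top_face_sublinear.
(* A chain of faces is bounded by its pointwise infimum, and a minimal face is equal
   to all of its top faces. *)
pose T := {p | [/\ sublinear_on p, le_on p p0 & face_of q p]}.
have t0 : T.
  by exists p0; split=> //; exact: top_face_face.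
pose le_T (f g : T) := `[< le_on (sval g) (sval f) >].
have [[p [psub pp0 pface]] pmin] : exists t, premaximal le_T t.
  apply: (ZL_preorder t0) => [t|r s t /asboolP rs /asboolP st|C Ctot].
  - by apply/asboolP => x _; exact: lexx.
  - by apply/asboolP => x Dx; exact: le_trans (st x Dx) (rs x Dx).
  have [[c Cc]|C0] := pselect (C !=set0); last first.
    by exists t0 => s Cs; case: C0; exists s.
  pose m x := inf [set sval t x | t in C].
  have m_lb x : D x -> has_lbound [set sval t x | t in C].
    move=> Dx; exists (- p0 (- x)) => _ [t Ct <-]; have [tsub tp0 _] := svalP t.
    by apply: le_trans (sublinear_opp tsub Dx); rewrite lerN2; apply/tp0/D_opp.
  have m_le t : C t -> le_on m (sval t).
    by move=> Ct x Dx; apply: ge_inf; [exact: m_lb|exists t].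
  have le_m x r : (forall t, C t -> r <= sval t x) -> r <= m x.
    move=> h; apply: lb_le_inf; first by exists (sval c x), c.
    by move=> _ [t Ct <-]; exact: h.
  have msub : sublinear_on m.
    split=> [x y Dx Dy|k x k0 Dx].
      rewrite -lerBlDr; apply: (le_m) => t Ct.
      rewrite lerBlDr -lerBlDl; apply: (le_m) => s Cs; rewrite lerBlDl.
      have [tsub _ _] := svalP t; have [ssub _ _] := svalP s.
      have [/asboolP/(_ y Dy) ts|/asboolP/(_ x Dx) st] := Ctot _ _ Cs Ct.
        apply: le_trans (m_le _ Ct _ (DD Dx Dy)) _.
        apply: le_trans (sublinearD tsub Dx Dy) _.
        by rewrite lerD2l.
      apply: le_trans (m_le _ Cs _ (DD Dx Dy)) _.
      apply: le_trans (sublinearD ssub Dx Dy) _.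
      by rewrite lerD2r.
    apply/eqP; rewrite eq_le; apply/andP; split.
      move: k0; rewrite (le_eqVlt 0) => /predU1P[<-|k0].
        rewrite scale0r mul0r; have [csub _ _] := svalP c.
        by rewrite -(sublinear0 csub Dx) -(scale0r x); exact/m_le/DZ.
      rewrite -ler_pdivrMl//; apply: (le_m) => t Ct; have [tsub _ _] := svalP t.
      rewrite ler_pdivrMl// -(sublinearZ tsub)// ?(ltW k0)//.
      by apply: (m_le _ Ct); exact: DZ.
    apply: (le_m) => t Ct; have [tsub _ _] := svalP t.
    by rewrite (sublinearZ tsub)// ler_wpM2l//; exact: m_le.
  have mT : [/\ sublinear_on m, le_on m p0 & face_of q m].
    split=> // [x Dx|L1 L2 l1 l2 L1q L2q L12].
      by have [_ cp0 _] := svalP c; exact: le_trans (m_le _ Cc _ Dx) (cp0 _ Dx).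
    have below t : C t -> le_on L1 (sval t) /\ le_on L2 (sval t).
      move=> Ct; have [_ _ tface] := svalP t; apply: tface => // x Dx.
      by apply: le_trans (L12 _ Dx) _; rewrite ler_pM2l//; exact: m_le.
    by split=> x Dx; apply: (le_m) => t Ct; have [b1 b2] := below t Ct; auto.
  by exists (exist _ m mT) => s Cs; apply/asboolP; exact: m_le.
have p0q : le_on p0 q by exact: top_face_le.
have plin : linear_on p.
  apply: linear_of_top_face => // v Dv.
  have pv : [/\ sublinear_on (top_face p v), le_on (top_face p v) p0
             & face_of q (top_face p v)].
    have vp := top_face_le psub Dv.
    split; first exact: top_face_sublinear.
      by move=> x Dx; exact: le_trans (vp x Dx) (pp0 x Dx).
    move=> L1 L2 l1 l2 L1q L2q L12; have [L1p L2p] : le_on L1 p /\ le_on L2 p.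
      apply: (pface) => // x Dx; apply: le_trans (L12 _ Dx) _.
      by rewrite ler_pM2l//; exact: vp.
    exact: top_face_face.
  exact/asboolP/(pmin (exist _ _ pv))/asboolP/top_face_le.
have pq : le_on p q by move=> x Dx; exact: le_trans (pp0 x Dx) (p0q x Dx).
exists p; split=> //.
  apply/eqP; rewrite eq_le pq//=.
  have := pp0 _ (D_opp Dv0); rewrite -scaleN1r plin.2// scaleN1r.
  by have := top_face_oppr qsub Dv0; rewrite -/p0; lra.
move=> L1 L2 l1 l2 L1q L2q L12 x Dx.
have [L1p L2p] : le_on L1 p /\ le_on L2 p by apply: (pface) => // y Dy; rewrite L12.
by have := L1p x Dx; have := L2p x Dx; have := L12 x Dx; lra.
Qed.

End extreme_hahn_banach.

(** * States as means over the homomorphisms *)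

Section bauer.
Context {R : realType} {A : mvalgType}.
Implicit Types (s t h : A -> R) (l : seq (R * A)).

Definition lincomb l t : R := \sum_(i <- l) i.1 * t i.2.

Lemma lincomb_nil t : lincomb [::] t = 0.
Proof. by rewrite /lincomb big_nil. Qed.

Lemma lincomb_cons (c : R) (a : A) l t : lincomb ((c, a) :: l) t = c * t a + lincomb l t.
Proof. by rewrite /lincomb big_cons. Qed.

Lemma lincomb1 (c : R) (a : A) t : lincomb [:: (c, a)] t = c * t a.
Proof. by rewrite lincomb_cons lincomb_nil addr0. Qed.

Lemma lincomb_cat l1 l2 t : lincomb (l1 ++ l2) t = lincomb l1 t + lincomb l2 t.
Proof. by rewrite /lincomb big_cat. Qed.

Definition scale_lincomb (c : R) l := [seq (c * i.1, i.2) | i <- l].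

Lemma lincomb_scale (c : R) l t : lincomb (scale_lincomb c l) t = c * lincomb l t.
Proof.
by rewrite /lincomb big_map mulr_sumr; apply: eq_bigr => i _; rewrite mulrA.
Qed.

Let eval_span : set ((A -> R) -> R^o) := [set lincomb l | l in setT].

Let eval_spanD f g : eval_span f -> eval_span g -> eval_span (f + g).
Proof.
move=> [l _ <-] [k _ <-]; exists (l ++ k) => //.
by apply/funext => t; rewrite lincomb_cat.
Qed.

Let eval_spanZ (c : R) f : eval_span f -> eval_span (c *: f).
Proof.
move=> [l _ <-]; exists (scale_lincomb c l) => //.
by apply/funext => t; rewrite lincomb_scale.
Qed.

Let sup_states (f : (A -> R) -> R^o) : R := sup [set (f t : R) | t in @mv_state R A].

Let lincomb_le l t : mv_state t -> lincomb l t <= \sum_(i <- l) `|i.1|.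
Proof.
move=> ht; rewrite /lincomb; apply: ler_sum => i _; have [/(_ i.2)/andP[t0 t1] _ _] := ht.
apply: le_trans (ler_norm _) _.
by rewrite normrM (ger0_norm t0) ler_piMr.
Qed.

(** Bauer's principle: the minimum over the states of a linear combination of
    evaluations is attained at an extreme state, and this one is a homomorphism. *)
Lemma lincomb_ge0_of_hom l s : mv_state s ->
  (forall h, unit_hom h -> 0 <= lincomb l h) -> 0 <= lincomb l s.
Proof.
move=> hs hom_ge0; set q := sup_states.
have q_has f : eval_span f -> has_sup [set (f t : R) | t in @mv_state R A].
  move=> [k _ <-]; split; first by exists (lincomb k s), s.
  by exists (\sum_(i <- k) `|i.1|) => _ [t ht <-]; exact: lincomb_le.
have q_ub f t : eval_span f -> mv_state t -> f t <= q f.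
  by move=> Df ht; apply: ub_le_sup; [exact: (q_has _ Df).2|exists t].
have q_le f (r : R) : (forall t, mv_state t -> f t <= r) -> q f <= r.
  by move=> h; apply: ge_sup; [exists (f s), s|move=> _ [t ht <-]; exact: h].
have q_sub : sublinear_on eval_span q.
  split=> [f g Df Dg|c f c0 Df].
    by apply: q_le => t ht; apply: lerD; exact: q_ub.
  apply/eqP; rewrite eq_le; apply/andP; split.
    by apply: q_le => t ht; apply: ler_wpM2l => //; exact: q_ub.
  move: c0; rewrite (le_eqVlt 0) => /predU1P[<-|c0].
    have := q_ub _ s (eval_spanZ 0 Df) hs.
    by rewrite -[X in X <= _]/(0 * f s) !mul0r.
  rewrite -ler_pdivlMl//; apply: q_le => t ht.
  by rewrite ler_pdivlMl//; exact: (q_ub _ t (eval_spanZ c Df) ht).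
(* The extreme functional below [q], read on the evaluations, is a state. *)
have Dlincomb k : eval_span (lincomb k) by exists k.
have [L [[LD LZ] Lq Lmax Lext]] :=
  extreme_hahn_banach eval_spanD eval_spanZ q_sub (Dlincomb (scale_lincomb (-1) l)).
pose ev a : (A -> R) -> R^o := fun t => t a.
have Dev a : eval_span (ev a).
  by exists [:: (1, a)] => //; apply/funext => t; rewrite lincomb1 mul1r.
pose t a := L (ev a).
have Llincomb k L' : linear_on eval_span L' -> L' (lincomb k) = lincomb k (fun a => L' (ev a)).
  move=> [LD' LZ']; elim: k => [|[c a] k IH].
    have -> : lincomb [::] = 0 *: ev mvzero :> (_ -> R^o).
      by apply/funext => u; rewrite lincomb_nil -[RHS]/(0 * _) mul0r.
    by rewrite LZ'// mul0r lincomb_nil.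
  have -> : lincomb ((c, a) :: k) = c *: ev a + lincomb k :> (_ -> R^o).
    by apply/funext => u; rewrite lincomb_cons.
  by rewrite LD' ?LZ'// ?IH ?lincomb_cons//; exact: eval_spanZ.
have Lle f (r : R) : eval_span f -> (forall u, mv_state u -> f u <= r) -> L f <= r.
  by move=> Df h; apply: le_trans (Lq _ Df) _; exact: q_le.
have Lge f (r : R) : eval_span f -> (forall u, mv_state u -> r <= f u) -> r <= L f.
  move=> Df h; have := Lle (-1 *: f) (- r) (eval_spanZ _ Df).
  rewrite LZ// mulN1r lerN2; apply=> u hu.
  by rewrite -[X in X <= _]/(-1 * f u) mulN1r lerN2; exact: h.
have ht : mv_state t.
  split=> [a||a b ab].
  - by rewrite Lge ?Lle// => u [] /(_ a)/andP[].
  - by apply/eqP; rewrite eq_le Lle ?Lge// => u [_ u1 _]; rewrite /ev u1.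
  - have Dab := eval_spanD (Dev a) (Dev b).
    rewrite /t -LD//; apply/eqP; rewrite eq_le.
    have Dd : eval_span (ev (a ⊕ b)%MV + -1 *: (ev a + ev b)).
      by apply: eval_spanD => //; exact: eval_spanZ.
    have d0 u : mv_state u -> (ev (a ⊕ b)%MV + -1 *: (ev a + ev b)) u = 0.
      move=> [_ _ uD]; rewrite -[LHS]/(u (a ⊕ b)%MV + -1 * (u a + u b)).
      by rewrite uD// mulN1r subrr.
    have e : L (ev (a ⊕ b)%MV) + -1 * L (ev a + ev b) = 0.
      rewrite -LZ// -LD//; last exact: eval_spanZ.
      by apply/eqP; rewrite eq_le Lle ?Lge// => u /d0 ->.
    by move: e; rewrite mulN1r => /subr0_eq ->; rewrite lexx.
(* Evaluations at states are functionals below [q], so a midpoint decomposition of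
   [t] is one of [L]. *)
have text : extreme_state t.
  split=> // t1 t2 ht1 ht2 t12 a.
  have lin_at u : linear_on eval_span (fun f => f u : R) by [].
  have at_le u : mv_state u -> le_on eval_span (fun f => f u : R) q.
    by move=> hu f Df; exact: q_ub.
  apply: (Lext (fun f => f t1) (fun f => f t2)) => //; try exact: at_le.
  move=> _ [k _ <-]; rewrite (Llincomb k L)// /lincomb -big_split/= mulr_sumr.
  by apply: eq_bigr => i _; rewrite -mulrDr t12/= mulrCA.
have := hom_ge0 _ (extreme_state_hom text).
have := q_ub _ s (Dlincomb (scale_lincomb (-1) l)) hs; rewrite -Lmax (Llincomb _ L)//.
by rewrite !lincomb_scale !mulN1r lerN2 => ts /le_trans; exact.
Qed.

End bauer.

Section means.
Context {R : realType} {Y : Type}.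

Definition bounded_map (f : Y -> R^o) : Prop :=
  exists M : R, forall y, `|(f y : R)| <= M.

Lemma bounded_mapD f g : bounded_map f -> bounded_map g -> bounded_map (f + g).
Proof.
move=> [M fM] [N gN]; exists (M + N) => y.
by apply: le_trans (ler_normD _ _) _; exact: lerD.
Qed.

Lemma bounded_mapZ (c : R) f : bounded_map f -> bounded_map (c *: f).
Proof.
move=> [M fM]; exists (`|c| * M) => y.
by rewrite -[X in `|X|]/(c * f y) normrM ler_wpM2l.
Qed.

(** A finitely additive expectation, defined on all bounded functions. *)
Definition mean (L : (Y -> R^o) -> R) : Prop :=
  [/\ linear_on bounded_map L,
      forall f, bounded_map f -> (forall y, 0 <= (f y : R)) -> 0 <= L f
    & L (cst 1) = 1].

End means.

Section state_mean.
Context {R : realType} {A : mvalgType}.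

Definition hom_space : Type := {h : A -> R | unit_hom h}.

Definition hom_eval (a : A) (h : hom_space) : R^o := sval h a.

(** The functional [p f = inf {g(s) | f <= g}], with [g] running over the linear
    combinations of evaluations, is sublinear, finite by Bauer's principle, and any
    linear functional below it is a mean with the prescribed values. *)
Theorem state_is_mean (s : A -> R) : mv_state s ->
  exists2 L : (hom_space -> R^o) -> R, mean L & forall a, L (hom_eval a) = s a.
Proof.
move=> hs; have [_ s1 _] := hs.
pose above (f : hom_space -> R^o) := [set l : seq (R * A) |
  forall h : hom_space, (f h : R) <= lincomb l (sval h)].
pose p f := inf [set lincomb l s | l in above f].
have hom1 (h : hom_space) : sval h (mvneg mvzero) = 1 by have [[_ -> _] _] := svalP h.
have cst_above f (M : R) : (forall h, (f h : R) <= M) -> above f [:: (M, mvneg mvzero)].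
  by move=> fM h; rewrite lincomb1 hom1 mulr1.
have above_ge f l (M : R) : (forall h, M <= (f h : R)) -> above f l -> M <= lincomb l s.
  move=> fM fl; have := @lincomb_ge0_of_hom _ _ ((- M, mvneg mvzero) :: l) s hs.
  rewrite lincomb_cons s1 mulr1 addrC subr_ge0; apply=> h hh.
  have [[_ h1 _] _] := hh; rewrite lincomb_cons h1 mulr1 addrC subr_ge0.
  exact: le_trans (fM (exist _ h hh)) (fl _).
have p_le f l : bounded_map f -> above f l -> p f <= lincomb l s.
  move=> [M fM] fl; apply: ge_inf; last by exists l.
  exists (- M) => _ [k fk <-]; apply: above_ge fk => h.
  by have := fM h; rewrite ler_norml => /andP[].
have le_p f (m : R) : bounded_map f ->
    (forall l, above f l -> m <= lincomb l s) -> m <= p f.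
  move=> [M fM] h; apply: lb_le_inf; last by move=> _ [l fl <-]; exact: h.
  exists (lincomb [:: (M, mvneg mvzero)] s), [:: (M, mvneg mvzero)] => //.
  by apply: cst_above => y; exact: le_trans (ler_norm _) (fM y).
have psub : sublinear_on bounded_map p.
  split=> [f g bf bg|c f c0 bf].
    rewrite -lerBlDr; apply: (le_p) => // l fl.
    rewrite lerBlDr -lerBlDl; apply: (le_p) => // k gk.
    rewrite lerBlDl -lincomb_cat; apply: p_le; first exact: bounded_mapD.
    by move=> h; rewrite lincomb_cat; apply: lerD; [exact: fl|exact: gk].
  have above_scale (k : R) g l : 0 <= k -> above g l -> above (k *: g) (scale_lincomb k l).
    by move=> k0 gl h; rewrite lincomb_scale; apply: ler_wpM2l => //; exact: gl.
  apply/eqP; rewrite eq_le; apply/andP; split.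
    move: c0; rewrite (le_eqVlt 0) => /predU1P[<-|c0].
      rewrite mul0r; have := p_le _ [::] (bounded_mapZ 0 bf); rewrite lincomb_nil.
      by apply=> h; rewrite lincomb_nil -[X in X <= _]/(0 * f h) mul0r.
    rewrite -ler_pdivrMl//; apply: (le_p) => // l fl; rewrite ler_pdivrMl// -lincomb_scale.
    by apply: p_le; [exact: bounded_mapZ|apply: above_scale => //; exact: ltW].
  apply: (le_p) => [|l fl]; first exact: bounded_mapZ.
  move: c0; rewrite (le_eqVlt 0) => /predU1P[c0|c0].
    rewrite -c0 mul0r; apply: above_ge fl => h.
    by rewrite -c0 -[X in _ <= X]/(0 * f h) mul0r.
  rewrite -ler_pdivlMl// -lincomb_scale; apply: p_le => //.
  have -> : f = c^-1 *: (c *: f) by rewrite scalerA mulVf ?gt_eqF// scale1r.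
  by apply: above_scale => //; rewrite invr_ge0 ltW.
have b0 : bounded_map (0 : hom_space -> R^o) by exists 0 => y; rewrite normr0.
have [L [Llin Lp _ _]] := extreme_hahn_banach bounded_mapD bounded_mapZ psub b0.
have bev a : bounded_map (hom_eval a).
  exists 1 => h; have [[/(_ a)/andP[h0 h1] _ _] _] := svalP h.
  by rewrite /hom_eval ger0_norm.
have Lev a : L (hom_eval a) = s a.
  apply/eqP; rewrite eq_le; apply/andP; split.
    rewrite -[s a]mul1r -lincomb1; apply: le_trans (Lp _ (bev a)) _; apply: p_le => // h.
    by rewrite lincomb1 mul1r.
  rewrite -lerN2 -mulN1r -Llin.2// -[- s a]mulN1r -lincomb1.
  have bN : bounded_map (-1 *: hom_eval a) by exact: bounded_mapZ.
  by apply: le_trans (Lp _ bN) _; apply: p_le => // h; rewrite lincomb1.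
exists L => //; split; first exact: Llin.
  move=> f bf f0; rewrite -lerN2 oppr0 -mulN1r -Llin.2//.
  have bN : bounded_map (-1 *: f) by exact: bounded_mapZ.
  rewrite -(lincomb_nil s); apply: le_trans (Lp _ bN) _; apply: p_le => // h.
  by rewrite lincomb_nil -[X in X <= _]/(-1 * f h) mulN1r oppr_le0.
have -> : cst 1 = hom_eval (mvneg mvzero).
  by apply/funext => h; rewrite /hom_eval hom1.
by rewrite Lev.
Qed.

End state_mean.

(** * The Stone-Cech compactification of a discrete space *)

Lemma ultra_of_decisive (T : Type) (F : set_system T) :
  ProperFilter F -> (forall B, F B \/ F (~` B)) -> UltraFilter F.
Proof.
move=> FF Fdec; split=> // G GF FG; apply/seteqP; split=> // B GB.
have [//|/FG GCB] := Fdec B.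
have : G (B `&` ~` B) by exact: filterI.
by rewrite setICr => /filter_not_empty.
Qed.

(** The points are the ultrafilters, principal or not, on the discrete space. *)
Record stone_cech (Y : Type) := StoneCech {
  sc_filter :> set Y -> Prop ;
  sc_ultra : UltraFilter sc_filter }.

#[global] Existing Instance sc_ultra.

HB.instance Definition _ (Y : Type) := gen_eqMixin (stone_cech Y).
HB.instance Definition _ (Y : Type) := gen_choiceMixin (stone_cech Y).

Section stone_cech_topology.
Context {Y : Type}.
Implicit Types (x y : stone_cech Y) (B C : set Y).

Lemma sc_filterI x B C : x B -> x C -> x (B `&` C).
Proof. exact: filterI. Qed.

Lemma sc_filter_ex x B : x B -> exists p, B p.
Proof. exact: filter_ex. Qed.

Definition clopen_of B : set (stone_cech Y) := [set x : stone_cech Y | x B].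

Lemma clopen_ofC B : clopen_of (~` B) = ~` clopen_of B.
Proof.
apply/seteqP; split=> x /=; rewrite /clopen_of/=.
  move=> xCB xB.
  by have := sc_filterI xB xCB; rewrite setICr => /filter_not_empty.
by have [//|] := in_ultra_setVsetC B (sc_ultra x).
Qed.

Lemma clopen_ofI B C : clopen_of (B `&` C) = clopen_of B `&` clopen_of C.
Proof.
apply/seteqP; split=> x /=; rewrite /clopen_of/=; last by case; exact: filterI.
by move=> xBC; split; apply: filterS xBC => y [].
Qed.

Lemma clopen_ofU B C : clopen_of (B `|` C) = clopen_of B `|` clopen_of C.
Proof. by rewrite -[LHS]setCK -clopen_ofC setCU clopen_ofI !clopen_ofC setCI !setCK. Qed.

Lemma clopen_of0 : clopen_of set0 = set0.
Proof. by apply/seteqP; split=> x //= /filter_not_empty. Qed.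

Lemma clopen_ofT : clopen_of [set: Y] = setT.
Proof. by apply/seteqP; split=> x //= _; exact: filterT. Qed.

Lemma le_clopen_of B C : B `<=` C -> clopen_of B `<=` clopen_of C.
Proof. by move=> BC x; exact: filterS. Qed.

Definition principal (p : Y) : stone_cech Y := StoneCech (principal_filter_ultra p).

Lemma clopen_of_principal B (p : Y) : clopen_of B (principal p) <-> B p.
Proof. exact: principal_filterP. Qed.

Lemma clopen_of_le B C : clopen_of B `<=` clopen_of C -> B `<=` C.
Proof. by move=> BC y By; apply/clopen_of_principal/BC/clopen_of_principal. Qed.

Lemma stone_cech_eq x y : (forall B, x B -> y B) -> x = y.
Proof.
case: x => F FU; case: y => G GU /= FG.
have GF : G = F by apply: max_filter FG.
by subst G; congr StoneCech; exact: Prop_irrelevance.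
Qed.

Definition sc_open : set_system (stone_cech Y) :=
  [set U | forall x, U x -> exists2 B, x B & clopen_of B `<=` U].

Let sc_openT : sc_open setT.
Proof. by move=> x _; exists setT => //; exact: filterT. Qed.

Let sc_openI : setI_closed sc_open.
Proof.
move=> U V oU oV x [/oU[B xB BU] /oV[C xC CV]].
by exists (B `&` C); [exact: sc_filterI|rewrite clopen_ofI; exact: setISS].
Qed.

Let sc_open_bigU (I : Type) (f : I -> set (stone_cech Y)) :
  (forall i, sc_open (f i)) -> sc_open (\bigcup_i f i).
Proof.
move=> of_ x [i _ /of_[B xB Bf]]; exists B => //.
exact: subset_trans Bf (bigcup_sup _).
Qed.

HB.instance Definition _ := isOpenTopological.Build (stone_cech Y)
  sc_openT sc_openI sc_open_bigU.

Lemma stone_cech_openP (U : set (stone_cech Y)) :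
  open U <-> forall x, U x -> exists2 B, x B & clopen_of B `<=` U.
Proof. by []. Qed.

Lemma open_clopen_of B : open (clopen_of B).
Proof. by apply/stone_cech_openP => x xB; exists B. Qed.

Lemma nbhs_clopen_of x B : x B -> nbhs x (clopen_of B).
Proof. by move=> xB; apply: open_nbhs_nbhs; split=> //; exact: open_clopen_of. Qed.

Lemma stone_cech_hausdorff : hausdorff_space (stone_cech Y).
Proof.
move=> x y xy; apply: stone_cech_eq => B xB; apply: contrapT => nyB.
have yCB : y (~` B) by rewrite -[y _]/(clopen_of _ y) clopen_ofC.
have [z [zB]] := xy _ _ (nbhs_clopen_of xB) (nbhs_clopen_of yCB).
by rewrite clopen_ofC.
Qed.

(** The limit of an ultrafilter [F] on the space consists of the [B] whose clopen
    set belongs to [F]. *)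
Lemma stone_cech_compact : compact [set: stone_cech Y].
Proof.
rewrite compact_ultra => F FU _.
pose G : set_system Y := [set B | F (clopen_of B)].
have GU : UltraFilter G.
  apply: ultra_of_decisive.
    split; first by rewrite /G/= clopen_of0; exact: filter_not_empty.
    split.
    - by rewrite /G/= clopen_ofT; exact: filterT.
    - by move=> B C FB FC; rewrite /G/= clopen_ofI; exact: filterI.
    - by move=> B C /le_clopen_of BC; rewrite /G/=; exact: filterS.
  by move=> B; rewrite /G/= clopen_ofC; exact: in_ultra_setVsetC.
exists (StoneCech GU); split=> // U.
rewrite nbhsE => -[V [oV Vx] VU].
have [B GB BV] := (stone_cech_openP V).1 oV _ Vx.
by apply: (@filterS _ F _ (clopen_of B)) GB; exact: subset_trans BV VU.
Qed.

(** The closure of a union of clopen sets [clopen_of B] is the clopen set of the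
    union [W] of the [B]: outside of it the complement of [W] is a neighbourhood, and
    inside of it every neighbourhood contains a principal ultrafilter at a point
    of [W]. *)
Lemma stone_cech_ed : extremally_disconnected (stone_cech Y).
Proof.
move=> U oU; pose W := [set p | exists2 B : set Y, clopen_of B `<=` U & B p].
suff -> : closure U = clopen_of W by exact: open_clopen_of.
apply/seteqP; split=> x.
  move=> clx; apply: contrapT => nxW.
  have xCW : x (~` W) by rewrite -[x _]/(clopen_of _ x) clopen_ofC.
  have [z [Uz]] := clx _ (nbhs_clopen_of xCW).
  rewrite clopen_ofC; apply.
  have [B zB BU] := (stone_cech_openP U).1 oU _ Uz.
  by apply: filterS zB => p Bp; exists B.
move=> xW N; rewrite nbhsE => -[V [oV Vx] VN].
have [C xC CV] := (stone_cech_openP V).1 oV _ Vx.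
have /sc_filter_ex[p [Cp [B BU Bp]]] := sc_filterI xC xW.
by exists (principal p); split; [apply: BU|apply/VN/CV]; exact/clopen_of_principal.
Qed.

End stone_cech_topology.

HB.instance Definition _ (Y : pointedType) :=
  isPointed.Build (stone_cech Y) (principal (@point Y)).

(** * The Borel probability of a mean *)

Section mean_properties.
Context {R : realType} {Y : Type} {L : (Y -> R^o) -> R} (L_mean : mean L).
Implicit Types (B C : set Y) (f g : Y -> R^o).

Lemma meanD f g : bounded_map f -> bounded_map g -> L (f + g) = L f + L g.
Proof. by case: L_mean => -[LD _] _ _; exact: LD. Qed.

Lemma meanZ (c : R) f : bounded_map f -> L (c *: f) = c * L f.
Proof. by case: L_mean => -[_ LZ] _ _; exact: LZ. Qed.

Lemma mean_le f g : bounded_map f -> bounded_map g ->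
  (forall y, (f y : R) <= g y) -> L f <= L g.
Proof.
move=> bf bg fg; have [_ L0 _] := L_mean.
have bN : bounded_map (-1 *: f) by exact: bounded_mapZ.
rewrite -subr_ge0 -mulN1r -meanZ// -meanD//; apply: L0; first exact: bounded_mapD.
by move=> y; rewrite -[X in _ <= X]/(g y + -1 * f y) mulN1r subr_ge0.
Qed.

Lemma bounded_01 f : (forall y, 0 <= (f y : R) <= 1) -> bounded_map f.
Proof. by move=> f01; exists 1 => y; have /andP[f0 f1] := f01 y; rewrite ger0_norm. Qed.

Lemma bounded_map_indic B : bounded_map (\1_B : Y -> R).
Proof. by apply: bounded_01 => y; rewrite indicE ler0n lern1 leq_b1. Qed.

Definition mean_set B : R := L (\1_B : Y -> R).

Lemma mean_setT : mean_set setT = 1.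
Proof. by have [_ _ L1] := L_mean; rewrite /mean_set indicT. Qed.

Lemma mean_set0 : mean_set set0 = 0.
Proof.
rewrite /mean_set indic0.
have b0 : bounded_map (cst 0 : Y -> R^o) by exists 0 => y; rewrite normr0.
by have := meanZ 0 b0; rewrite mul0r scale0r.
Qed.

Lemma mean_setU B C : B `&` C = set0 -> mean_set (B `|` C) = mean_set B + mean_set C.
Proof.
move=> BC; rewrite /mean_set -meanD; [|exact: bounded_map_indic|exact: bounded_map_indic].
congr L; apply/funext => y; rewrite -[RHS]/(\1_B y + \1_C y) !indicE in_setU.
have [yB|] := boolP (y \in B); last by rewrite add0r.
have [yC|] := boolP (y \in C); last by rewrite addr0.
have : set0 y by rewrite -BC; split; exact: set_mem.
by [].
Qed.

Lemma mean_set_le B C : B `<=` C -> mean_set B <= mean_set C.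
Proof.
move=> BC; apply: mean_le => [||y]; [exact: bounded_map_indic|exact: bounded_map_indic|].
rewrite !indicE ler_nat; have [/set_mem/BC/mem_set ->//|//] := boolP (y \in B).
Qed.

Lemma mean_set_le1 B : mean_set B <= 1.
Proof. by rewrite -mean_setT; apply: mean_set_le. Qed.

Lemma mean_setU_le B C : mean_set (B `|` C) <= mean_set B + mean_set C.
Proof.
have -> : B `|` C = B `|` (C `\` B).
  apply/seteqP; split=> y; last by case=> [|[]]; [left|right].
  by have [|] := pselect (B y); [left|move=> nB [//|Cy]; right].
rewrite mean_setU; last by apply/seteqP; split=> y // [? []].
by rewrite lerD2l; apply: mean_set_le => y [].
Qed.

(** The regular Borel extension of [mean_set] from the clopen sets: approximation
    from inside by clopen sets, then from outside by open sets. *)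
Definition inner_content (U : set (stone_cech Y)) : R :=
  sup [set mean_set B | B in [set B | clopen_of B `<=` U]].

Definition outer_value (E : set (stone_cech Y)) : R :=
  inf [set inner_content U | U in [set U | open U /\ E `<=` U]].

Lemma inner_content_ge U B : clopen_of B `<=` U -> mean_set B <= inner_content U.
Proof.
move=> BU; apply: ub_le_sup; last by exists B.
by exists 1 => _ [C _ <-]; exact: mean_set_le1.
Qed.

Lemma inner_content_le U (r : R) :
  (forall B, clopen_of B `<=` U -> mean_set B <= r) -> inner_content U <= r.
Proof.
move=> h; apply: ge_sup; last by move=> _ [B BU <-]; exact: h.
by exists (mean_set set0), set0 => //=; rewrite clopen_of0.
Qed.

Lemma inner_content_ge0 U : 0 <= inner_content U.
Proof. by rewrite -mean_set0; apply: inner_content_ge; rewrite clopen_of0. Qed.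

Lemma inner_content_clopen B : inner_content (clopen_of B) = mean_set B.
Proof.
apply/eqP; rewrite eq_le inner_content_ge// andbT; apply: inner_content_le => C.
by move=> /clopen_of_le; exact: mean_set_le.
Qed.

Lemma outer_value_le E U : open U -> E `<=` U -> outer_value E <= inner_content U.
Proof.
move=> oU EU; apply: ge_inf; last by exists U.
by exists 0 => _ [V _ <-]; exact: inner_content_ge0.
Qed.

Lemma le_outer_value E (r : R) :
  (forall U, open U -> E `<=` U -> r <= inner_content U) -> r <= outer_value E.
Proof.
move=> h; apply: lb_le_inf; last by move=> _ [U [oU EU] <-]; exact: h.
by exists (inner_content setT), setT => //; split=> //; exact: openT.
Qed.

Lemma outer_value_ge0 E : 0 <= outer_value E.
Proof. by apply: le_outer_value => U _ _; exact: inner_content_ge0. Qed.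

Lemma outer_value_mono E E' : E `<=` E' -> outer_value E <= outer_value E'.
Proof.
move=> EE'; apply: le_outer_value => U oU E'U; apply: outer_value_le => //.
exact: subset_trans EE' E'U.
Qed.

Lemma outer_value_clopen B : outer_value (clopen_of B) = mean_set B.
Proof.
apply/eqP; rewrite eq_le; apply/andP; split.
  by rewrite -inner_content_clopen; apply: outer_value_le => //; exact: open_clopen_of.
by apply: le_outer_value => U _; exact: inner_content_ge.
Qed.

(** Compactness: if no finite choice of clopen sets inside the [U n] covers
    [clopen_of B], the sets [D] such that [B minus D] is finitely coverable form a
    proper filter containing [B]; an ultrafilter above it lies in [clopen_of B] but
    in none of the [U n]. *)
Lemma clopen_of_finite_cover (U : nat -> set (stone_cech Y)) B :
  (forall n, open (U n)) -> clopen_of B `<=` \bigcup_n U n ->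
  exists N (C : nat -> set Y), (forall n, clopen_of (C n) `<=` U n) /\
    B `<=` \bigcup_(n in [set n | (n < N)%N]) C n.
Proof.
move=> oU BU.
pose coverable D := exists N (C : nat -> set Y), (forall n, clopen_of (C n) `<=` U n) /\
  D `<=` \bigcup_(n in [set n | (n < N)%N]) C n.
suff : coverable B by [].
have covU D D' : coverable D -> coverable D' -> coverable (D `|` D').
  move=> [N [C [CU DC]]] [N' [C' [CU' DC']]].
  exists (maxn N N'), (fun n => C n `|` C' n); split.
    by move=> n; rewrite clopen_ofU subUset.
  move=> y [/DC[n /= nN Cy]|/DC'[n /= nN Cy]]; exists n => /=.
  - by rewrite leq_max nN.
  - by left.
  - by rewrite leq_max nN orbT.
  - by right.
have covS D D' : D `<=` D' -> coverable D' -> coverable D.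
  by move=> DD' [N [C [CU DC]]]; exists N, C; split=> //; exact: subset_trans DD' DC.
apply: contrapT => ncov.
pose F : set_system Y := [set D | coverable (B `\` D)].
have FF : ProperFilter F.
  split; first by rewrite /F/= setD0.
  split; rewrite /F/=.
  - rewrite setDT; exists 0%N, (fun=> set0); split=> [n|//].
    by rewrite clopen_of0.
  - by move=> D D' FD FD'; rewrite /mkset setDIr; exact: covU.
  - by move=> D D' DD'; apply: covS; exact: setDS.
have [G [GU FG]] := ultraFilterLemma FF.
pose x := StoneCech GU.
have [n _ Unx] : (\bigcup_n U n) x.
  apply: BU; apply: FG; rewrite /F/= setDv.
  by exists 0%N, (fun=> set0); split=> [n|//]; rewrite clopen_of0.
have [C xC CU] := (stone_cech_openP _).1 (oU n) _ Unx.
have xCC : x (~` C).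
  apply: FG; exists n.+1, (fun k => if k == n then C else set0); split.
    by move=> k; case: eqP => [->//|_]; rewrite clopen_of0.
  by move=> y [_ /contrapT Cy]; exists n => //=; rewrite eqxx.
by have := sc_filterI xC xCC; rewrite setICr => /filter_not_empty.
Qed.

Lemma mean_set_bigcup_le N (C : nat -> set Y) :
  mean_set (\bigcup_(n in [set n | (n < N)%N]) C n) <= \sum_(0 <= n < N) mean_set (C n).
Proof.
elim: N => [|N IH].
  rewrite big_nil -mean_set0; apply: mean_set_le => y [n].
  by rewrite /= ltn0.
rewrite big_nat_recr//=; apply: (@le_trans _ _
  (mean_set ((\bigcup_(n in [set n | (n < N)%N]) C n) `|` C N))).
  apply: mean_set_le => y [n /=]; rewrite ltnS leq_eqVlt => /predU1P[->|nN] Cy.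
    by right.
  by left; exists n.
by apply: le_trans (mean_setU_le _ _) _; rewrite lerD2r.
Qed.

Lemma inner_content_bigcup (U : nat -> set (stone_cech Y)) :
  (forall n, open (U n)) ->
  ((inner_content (\bigcup_n U n))%:E <= \sum_(n <oo) (inner_content (U n))%:E)%E.
Proof.
move=> oU.
have U0 n : (0 <= (inner_content (U n))%:E)%E by rewrite lee_fin inner_content_ge0.
have le_sum B : clopen_of B `<=` \bigcup_n U n ->
    ((mean_set B)%:E <= \sum_(n <oo) (inner_content (U n))%:E)%E.
  move=> /(clopen_of_finite_cover oU)[N [C [CU BC]]].
  apply: le_trans (nneseries_lim_ge (m := 0%N) (P := xpredT) N _); last by move=> n _ _.
  rewrite sumEFin lee_fin; apply: le_trans (mean_set_le BC) _.
  apply: le_trans (mean_set_bigcup_le _ _) _.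
  by apply: ler_sum => n _; exact: inner_content_ge.
case: (\sum_(n <oo) _)%E le_sum => [r h||/(_ set0)].
- by rewrite lee_fin; apply: inner_content_le => B /h; rewrite lee_fin.
- by rewrite leey.
- by rewrite clopen_of0 => /(_ (@sub0set _ _)).
Qed.

End mean_properties.

Arguments mean_set {R Y} L B.
Arguments inner_content {R Y} L U.
Arguments outer_value {R Y} L E.

(** The outer value is an outer measure for which open sets are measurable in the
    sense of Caratheodory, so its restriction to the Borel sets is a measure. *)
Section borel_mean.
Context {R : realType} {Y : pointedType} {L : (Y -> R^o) -> R} (L_mean : mean L).

Let outer_mean : set (stone_cech Y) -> \bar R := fun E => (outer_value L E)%:E.

Let outer_mean0 : outer_mean set0 = 0%E.
Proof. by rewrite /outer_mean -(@clopen_of0 Y) outer_value_clopen// mean_set0. Qed.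

Let outer_mean_ge0 E : (0 <= outer_mean E)%E.
Proof. by rewrite lee_fin outer_value_ge0. Qed.

Let outer_mean_mono : {homo outer_mean : E E' / E `<=` E' >-> (E <= E')%E}.
Proof. by move=> E E' EE'; rewrite lee_fin; exact: (outer_value_mono L_mean). Qed.

Let outer_mean_sigma_subadditive : sigma_subadditive outer_mean.
Proof.
move=> F; apply/lee_addgt0Pr => e e0.
apply: le_trans (epsilon_trick xpredT (fun n => outer_mean_ge0 (F n)) (ltW e0)).
have [U FU] : {U : nat -> set (stone_cech Y) & forall n, [/\ open (U n), F n `<=` U n &
    inner_content L (U n) <= outer_value L (F n) + e / (2 ^ n.+1)%:R]}.
  apply: (@choice _ _ (fun n V => [/\ open V, F n `<=` V &
    inner_content L V <= outer_value L (F n) + e / (2 ^ n.+1)%:R])) => n.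
  have en : 0 < e / (2 ^ n.+1)%:R by rewrite divr_gt0// ltr0n expn_gt0.
  apply: contrapT => nU; suff : outer_value L (F n) + e / (2 ^ n.+1)%:R <= outer_value L (F n).
    by rewrite gerDl leNgt en.
  apply: le_outer_value => V oV FV; rewrite leNgt; apply/negP => /ltW lt.
  by apply: nU; exists V.
have oU n : open (U n) by have [] := FU n.
apply: (@le_trans _ _ (inner_content L (\bigcup_n U n))%:E).
  rewrite lee_fin; apply: (outer_value_le L_mean); first exact: bigcup_open.
  by move=> x [n _ Fx]; exists n => //; have [_ + _] := FU n; apply.
apply: le_trans (inner_content_bigcup L_mean oU) _; apply: lee_nneseries => [n _ _|n _].
  by rewrite lee_fin inner_content_ge0.
by rewrite /outer_mean -EFinD lee_fin; have [] := FU n.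
Qed.

HB.instance Definition _ := isOuterMeasure.Build R (stone_cech Y) outer_mean
  outer_mean0 outer_mean_ge0 outer_mean_mono outer_mean_sigma_subadditive.

(** For [V] open containing [E], exhaust first [V /\ U] by a clopen set, then the
    rest of [V] by a second one. *)
Let open_caratheodory U : open U -> outer_mean.-caratheodory U.
Proof.
move=> oU; apply: le_caratheodory_measurable => E.
rewrite -EFinD lee_fin; apply: le_outer_value => V oV EV.
rewrite -lerBrDr.
apply: (@le_trans _ _ (inner_content L (V `&` U))).
  by apply: (outer_value_le L_mean); [exact: openI|exact: setSI].
apply: inner_content_le => B BVU; rewrite lerBrDr -lerBrDl.
apply: (@le_trans _ _ (inner_content L (V `&` clopen_of (~` B)))).
  apply: (outer_value_le L_mean); first by apply: openI => //; exact: open_clopen_of.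
  move=> x [/EV Vx nUx]; split=> //; rewrite clopen_ofC => /BVU[_]; exact: nUx.
apply: inner_content_le => C CVB; rewrite lerBrDl -(mean_setU L_mean).
  apply: (inner_content_ge L_mean); rewrite clopen_ofU subUset; split.
    by move=> x /BVU[].
  by move=> x /CVB[].
apply/seteqP; split=> y // [By Cy].
have : clopen_of C (principal y) by apply/clopen_of_principal.
by move=> /CVB[_ /clopen_of_principal]; exact.
Qed.



Let borel_caratheodory : @measurable _ (borel (stone_cech Y)) `<=` outer_mean.-caratheodory.
Proof.
apply: smallest_sub; last exact: open_caratheodory.
split; first exact: caratheodory_measurable_set0.
  by move=> A mA; rewrite setTD; exact: caratheodory_measurable_setC.
by move=> A mA; exact: caratheodory_measurable_bigcup.
Qed.

Let borel_mu : set (borel (stone_cech Y)) -> \bar R := outer_mean.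

Let borel_mu_sigma_additive : semi_sigma_additive borel_mu.
Proof.
move=> A mA tA mUA; apply: (caratheodory_measure_sigma_additive (mu := outer_mean)) => //.
  by move=> i; apply: borel_caratheodory; exact: mA.
exact: borel_caratheodory.
Qed.

HB.instance Definition _ := isMeasure.Build _ _ _ borel_mu
  outer_mean0 outer_mean_ge0 borel_mu_sigma_additive.

Let borel_muT : borel_mu setT = 1%E.
Proof.
by rewrite /borel_mu /outer_mean -(@clopen_ofT Y) outer_value_clopen// mean_setT.
Qed.

HB.instance Definition _ := Measure_isProbability.Build _ _ _ borel_mu borel_muT.

Lemma mean_borel_probability : exists mu : probability (borel (stone_cech Y)) R,
  forall B : set Y, mu (clopen_of B) = (mean_set L B)%:E.
Proof.
exists borel_mu => B.
by have := congr1 EFin (outer_value_clopen L_mean B).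
Qed.

End borel_mean.

(** * Integrals of continuous extensions *)

Section continuous_extension.
Context {R : realType} {Y : Type}.
Implicit Types (x : stone_cech Y) (f g : Y -> R^o).

(** The limit of [f] along the ultrafilter [x]. *)
Definition sc_ext f x : R := sup [set r : R | x [set y | r <= (f y : R)]].

Lemma sc_ext_near f x (e : R) : bounded_map f -> 0 < e ->
  x [set y | `|(f y : R) - sc_ext f x| < e].
Proof.
move=> [M fM] e0; pose S := [set r : R | x [set y | r <= (f y : R)]].
have Sub : has_ubound S.
  exists M => r xr; have [y /= ry] := filter_ex xr.
  by apply: le_trans ry _; exact: le_trans (ler_norm _) (fM y).
have S0 : S !=set0.
  exists (- M); rewrite /S/=; have : x setT by exact: filterT.
  apply: filterS => y _ /=.
  by have := fM y; rewrite ler_norml => /andP[].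
have [r Sr lt_r] := sup_adherent e0 (conj S0 Sub).
have xlt : x [set y | (f y : R) < sc_ext f x + e].
  have [|xC] := in_ultra_setVsetC [set y | sc_ext f x + e <= (f y : R)] (sc_ultra x).
    by move=> h; have : S (sc_ext f x + e) by []; move/(ub_le_sup Sub); rewrite gerDl leNgt e0.
  by apply: filterS xC => y /= /negP; rewrite -ltNge.
have := sc_filterI (x := x) Sr xlt; apply: filterS => y /= [ry lt_y].
rewrite ltr_norml ltrBlDl lt_y andbT ltrBrDl.
exact: lt_le_trans lt_r ry.
Qed.

Lemma sc_ext_unique f x (c : R) : bounded_map f ->
  (forall e : R, 0 < e -> x [set y | `|(f y : R) - c| < e]) -> sc_ext f x = c.
Proof.
move=> bf fc; apply/eqP; rewrite -subr_eq0 -normr_eq0; apply/negPn/negP => ne0.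
have e0 : 0 < `|sc_ext f x - c| / 2 by rewrite divr_gt0// lt_neqAle eq_sym ne0 normr_ge0.
have /sc_filter_ex[y /= [y1 y2]] := sc_filterI (sc_ext_near x bf e0) (fc _ e0).
have : `|sc_ext f x - c| <= `|(f y : R) - sc_ext f x| + `|(f y : R) - c|.
  by rewrite [X in _ <= X + _]distrC; apply: le_trans (ler_normD _ _); rewrite addrA subrK.
by lra.
Qed.

Lemma sc_ext_01 f x : (forall y, 0 <= (f y : R) <= 1) -> 0 <= sc_ext f x <= 1.
Proof.
move=> f01; apply/andP; split; apply/ler_addgt0Pr => e e0.
  have /sc_filter_ex[y /=] := sc_ext_near x (bounded_01 f01) e0.
  by have := f01 y; rewrite ltr_norml => /andP[? ?] /andP[? ?]; lra.
have /sc_filter_ex[y /=] := sc_ext_near x (bounded_01 f01) e0.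
by have := f01 y; rewrite ltr_norml => /andP[? ?] /andP[? ?]; lra.
Qed.

Lemma open_sc_ext_gt f (r : R) : bounded_map f -> open [set x | r < sc_ext f x].
Proof.
move=> bf; apply/stone_cech_openP => x /= rx.
pose e := (sc_ext f x - r) / 2; have e0 : 0 < e by rewrite divr_gt0// subr_gt0.
exists [set y | `|(f y : R) - sc_ext f x| < e]; first exact: sc_ext_near.
move=> z zB /=; have /sc_filter_ex[y /= [y1 y2]] := sc_filterI zB (sc_ext_near z bf e0).
by move: y1 y2; rewrite !ltr_norml /e => /andP[? ?] /andP[? ?]; lra.
Qed.

End continuous_extension.

Section integral.
Context {R : realType} {Y : pointedType} {L : (Y -> R^o) -> R} (L_mean : mean L).
Context (mu : probability (borel (stone_cech Y)) R).
Context (mu_clopen : forall B : set Y, mu (clopen_of B) = (mean_set L B)%:E).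
Implicit Types f g : Y -> R^o.

Lemma measurable_sc_ext f : bounded_map f ->
  measurable_fun [set: borel (stone_cech Y)] (sc_ext f : borel (stone_cech Y) -> R).
Proof.
move=> bf; apply: (measurability _ (RGenOInfty.measurableE R)) => // _ [_ [r ->] <-].
rewrite setTI; apply: open_measurable_borel.
suff -> : sc_ext f @^-1` `]r, +oo[ = [set x | r < sc_ext f x] by exact: open_sc_ext_gt.
by apply/seteqP; split=> x /=; rewrite in_itv/= andbT.
Qed.

Lemma integrable_sc_ext f : (forall y, 0 <= (f y : R) <= 1) ->
  mu.-integrable setT (EFin \o (sc_ext f : borel (stone_cech Y) -> R)).
Proof.
move=> f01; apply: measurable_bounded_integrable => //.
- by apply: (le_lt_trans _ (ltry 1)); exact: probability_le1.
- exact: measurable_sc_ext (bounded_01 f01).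
- exists 1; split=> // M M1 x _ /=; have /andP[x0 x1] := sc_ext_01 x f01.
  by rewrite ger0_norm// (le_trans x1)// ltW.
Qed.

(** Write [f = 1/2 1_B + 1/2 g] with [B] the set where [1/2 <= f], so that [g] has
    again values between 0 and 1. The two expectations agree on [1_B], so passing
    from [g] to [f] halves their difference, which never exceeds 1. *)
Lemma Rintegral_sc_ext f : (forall y, 0 <= (f y : R) <= 1) ->
  (\int[mu]_x sc_ext f x)%R = L f.
Proof.
move=> f01.
suff small n : forall f, (forall y, 0 <= (f y : R) <= 1) ->
    `|(\int[mu]_x sc_ext f x)%R - L f| <= 2^-1 ^+ n.
  apply/eqP; rewrite -subr_eq0 -normr_le0; apply/ler_addgt0Pr => e e0; rewrite add0r.
  apply: le_trans (small (Num.bound e^-1) f f01) _.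
  rewrite exprVn -[e]invrK lef_pV2 ?posrE ?invr_gt0 ?exprn_gt0//.
  by apply/ltW/upper_nthrootP; rewrite invrK.
elim: n => [|n IH] {}f {}f01.
  rewrite expr0.
  have I0 : 0 <= (\int[mu]_x sc_ext f x)%R.
    by apply: Rintegral_ge0 => x _; have /andP[] := sc_ext_01 x f01.
  have I1 : (\int[mu]_x sc_ext f x)%R <= 1.
    have -> : 1 = (\int[mu]_x (1 : R))%R :> R.
      rewrite Rintegral_cst// mul1r.
      by have := congr1 fine (probability_setT mu).
    apply: le_Rintegral => //; first exact: integrable_sc_ext.
      by apply: finite_measure_integrable_cst.
    by move=> x _; have /andP[] := sc_ext_01 x f01.
  have bf := bounded_01 f01.
  have [_ L0 _] := L_mean.
  have Lf0 : 0 <= L f by apply: L0 => // y; have /andP[] := f01 y.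
  have Lf1 : L f <= 1.
    rewrite -(mean_setT L_mean); apply: (mean_le L_mean) => //; first exact: bounded_map_indic.
    by move=> y; rewrite indicT; have /andP[] := f01 y.
  by rewrite ler_norml; apply/andP; split; lra.
pose B := [set y | 2^-1 <= (f y : R)].
pose g : Y -> R^o := fun y => 2 * (f y : R) - \1_B y.
have g01 y : 0 <= (g y : R) <= 1.
  rewrite /g indicE; have /andP[f0 f1] := f01 y.
  have [/set_mem By|/negP nBy] := boolP (y \in B).
    have {}By : 2^-1 <= (f y : R) := By.
    by rewrite /=; apply/andP; split; lra.
  have lt_f : (f y : R) < 2^-1 by rewrite ltNge; apply/negP => By; exact/nBy/mem_set.
  by rewrite /=; apply/andP; split; lra.
have bB : bounded_map (\1_B : Y -> R) := bounded_map_indic B.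
have bg := bounded_01 g01.
have f_eq : f = 2^-1 *: (\1_B : Y -> R^o) + 2^-1 *: g.
  apply/funext => y; rewrite -[RHS]/(2^-1 * \1_B y + 2^-1 * (2 * (f y : R) - \1_B y)).
  by field.
have Lf : L f = 2^-1 * mean_set L B + 2^-1 * L g.
  rewrite {1}f_eq (meanD L_mean) ?(meanZ L_mean)//; exact: bounded_mapZ.
have ext_f x : sc_ext f x = 2^-1 * \1_(clopen_of B) x + 2^-1 * sc_ext g x.
  apply: sc_ext_unique => [|e e0]; first exact: bounded_01.
  have xB : x [set y | \1_B y = \1_(clopen_of B) x :> R].
    have [xB|xCB] := in_ultra_setVsetC B (sc_ultra x).
      by move: (xB); apply: filterS => y By /=; rewrite !indicE !mem_set.
    have nxB : ~ clopen_of B x by rewrite -[~ _]/((~` clopen_of B) x) -clopen_ofC.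
    by apply: filterS xCB => y nBy /=; rewrite !indicE !memNset.
  have := sc_filterI xB (sc_ext_near x bg e0); apply: filterS => y /= [yB yg].
  have -> : (f y : R) = 2^-1 * \1_B y + 2^-1 * (g y : R) by rewrite /g; field.
  rewrite yB opprD addrACA subrr add0r -mulrBr normrM ger0_norm ?invr_ge0//.
  by move: yg; have := normr_ge0 ((g y : R) - sc_ext g x); lra.
have mB : measurable (clopen_of B : set (borel (stone_cech Y))).
  by apply: open_measurable_borel; exact: open_clopen_of.
have iB : mu.-integrable setT (EFin \o (\1_(clopen_of B) : borel (stone_cech Y) -> R)).
  exact: (integrable_indic mu mB).
have ig := integrable_sc_ext g01.
have intf : (\int[mu]_x sc_ext f x)%R =
    2^-1 * mean_set L B + 2^-1 * (\int[mu]_x sc_ext g x)%R.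
  under eq_Rintegral do rewrite ext_f.
  rewrite RintegralD//; [|exact: (integrableZl measurableT 2^-1 iB)|
                          exact: (integrableZl measurableT 2^-1 ig)].
  rewrite !RintegralZl//; congr (_ * _ + _).
  rewrite /Rintegral integral_indic// setIT.
  by have := congr1 fine (mu_clopen B).
rewrite intf Lf opprD addrACA subrr add0r -mulrBr normrM ger0_norm ?invr_ge0//.
by rewrite exprS ler_pM2l ?invr_gt0//; exact: IH.
Qed.

End integral.

(** * The representation *)

HB.instance Definition _ (R : realType) (A : mvalgType) := gen_eqMixin (@hom_space R A).
HB.instance Definition _ (R : realType) (A : mvalgType) := gen_choiceMixin (@hom_space R A).

Section representation.
Context {R : realType} {A : mvalgType}.

Lemma hom_eval_01 (a : A) (h : @hom_space R A) : 0 <= (hom_eval a h : R) <= 1.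
Proof. by have [[h01 _ _] _] := svalP h; exact: h01. Qed.

Lemma sc_ext_add (a b : A) (x : stone_cech (@hom_space R A)) :
  sc_ext (hom_eval (a ⊕ b)%MV) x =
  Num.min (sc_ext (hom_eval a) x + sc_ext (hom_eval b) x) 1.
Proof.
have bd c : bounded_map (@hom_eval R A c) := bounded_01 (hom_eval_01 c).
apply: sc_ext_unique => // e e0; have e2 : 0 < e / 2 by rewrite divr_gt0.
have := sc_filterI (sc_ext_near x (bd a) e2) (sc_ext_near x (bd b) e2).
apply: filterS => h /= [].
have -> : (hom_eval (a ⊕ b)%MV h : R) = Num.min ((hom_eval a h : R) + hom_eval b h) 1.
  by have [_ hD] := svalP h; exact: hD.
move: (hom_eval a h : R) (hom_eval b h : R) (sc_ext _ x) (sc_ext _ x) => p q t r.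
rewrite !ltr_norml => /andP[? ?] /andP[? ?].
by case: (leP (p + q) 1) => ?; case: (leP (r + t) 1) => ?; apply/andP; split; lra.
Qed.

Lemma sc_ext_neg (a : A) (x : stone_cech (@hom_space R A)) :
  sc_ext (hom_eval (a^*)%MV) x = 1 - sc_ext (hom_eval a) x.
Proof.
have bd c : bounded_map (@hom_eval R A c) := bounded_01 (hom_eval_01 c).
apply: sc_ext_unique => // e e0; have := sc_ext_near x (bd a) e0.
apply: filterS => h /=.
have -> : (hom_eval (a^*)%MV h : R) = 1 - (hom_eval a h : R).
  by have [hs _] := svalP h; exact: state_neg.
by rewrite !ltr_norml => /andP[? ?]; apply/andP; split; lra.
Qed.

(** Without homomorphisms the combination [- 1] would be nonnegative on all of them,
    hence at [s]. *)
Lemma hom_space_inhabited (s : A -> R) : mv_state s -> inhabited (@hom_space R A).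
Proof.
move=> hs; apply: contrapT => noh; have [_ s1 _] := hs.
have : 0 <= lincomb [:: (-1, mvneg mvzero)] s.
  apply: lincomb_ge0_of_hom => // h hh; case: noh; exact: (inhabits (exist _ h hh)).
by rewrite lincomb1 s1 mulr1 ler0N1.
Qed.

End representation.

(** Differences [a ⊙ b^*] detect the order, hence equality. *)
Lemma mv_morphism_injective (A B : mvalgType) (F : A -> B) : mv_morphism F ->
  (forall a, F a = 0%MV -> a = 0%MV) -> injective F.
Proof.
move=> [F0 FD FN] ker0; suff le a b : F a = F b -> (a <= b)%MV.
  by move=> a b ab; apply: mvle_anti; apply: le.
move=> ab; apply: ker0; rewrite /mvmul FN FD !FN mvnegK ab mvadd_negx.
exact: mvnegK.
Qed.

Theorem theorem2p1 (R : realType) (A : mvalgType) (s : A -> R) :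
  mv_state s ->
  exists (X : L_space R) (F : A -> unitL1 (Lsp_mu X)),
    [/\ mv_morphism F,
        forall a : A, (s a)%:E = (\int[Lsp_mu X]_x (F a x)%:E)%E
      & mv_faithful s -> injective F].
Proof.
move=> s_state; have [L L_mean L_eval] := state_is_mean s_state.
have [h0] := hom_space_inhabited s_state.
pose Y : pointedType := HB.pack (@hom_space R A) (isPointed.Build (@hom_space R A) h0).
have [mu mu_clopen] := @mean_borel_probability R Y L L_mean.
pose X : L_space R := LSpace mu (@stone_cech_compact Y) (@stone_cech_hausdorff Y)
  (@stone_cech_ed Y).
pose ev a : borel (stone_cech Y) -> R := sc_ext (hom_eval a : Y -> R^o).
have ev_measurable a : measurable_fun [set: borel (stone_cech Y)] (ev a).
  exact: (@measurable_sc_ext R Y _ (bounded_01 (hom_eval_01 a))).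
have ev_01 a : \forall x \ae mu, 0 <= ev a x <= 1.
  by apply: aeW => x; exact: sc_ext_01 (hom_eval_01 a).
pose F a : unitL1 (Lsp_mu X) := unitL1_of (mu := mu) (ev_measurable a) (ev_01 a).
have FE a : F a = ev a %[ae mu] := unitL1_ofE (mu := mu) (ev_measurable a) (ev_01 a).
have F_neg a : F (a^*)%MV = ((F a)^*)%MV.
  apply: unitL1_eq.
  apply: filterS3 (FE a) (FE (a^*)%MV) (unitL1_negE (F a)) => x ea eN -> _.
  by rewrite ea// eN//; exact: sc_ext_neg.
have F_add a b : F (a ⊕ b)%MV = (F a ⊕ F b)%MV.
  apply: unitL1_eq; apply: filter_app (FE (a ⊕ b)%MV).
  apply: filterS3 (FE a) (FE b) (unitL1_addE (F a) (F b)) => x ea eb -> eab _.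
  by rewrite eab// ea// eb//; exact: sc_ext_add.
have F_mor : mv_morphism F.
  split=> //.
  by rewrite -[in LHS](mvnegK mvzero) -(mvadd_negx mvzero) F_neg F_add F_neg mvadd_negx mvnegK.
have F_int a : (s a)%:E = (\int[mu]_x (F a x)%:E)%E.
  have -> : (\int[mu]_x (F a x)%:E = \int[mu]_x (ev a x)%:E)%E.
    apply: ae_eq_integral => //.
    - by apply/measurable_EFinP; exact: measurable_unitL1.
    - by apply/measurable_EFinP.
    - by apply: filterS (FE a) => x e _; rewrite e.
  rewrite -L_eval -(@Rintegral_sc_ext R Y L L_mean mu mu_clopen _ (hom_eval_01 a)) fineK//.
  apply: integrable_fin_num => //; exact: (@integrable_sc_ext R Y mu _ (hom_eval_01 a)).
exists X, F; split=> // s_faithful; apply: mv_morphism_injective => // a Fa0.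
apply: s_faithful; apply: EFin_inj; rewrite F_int Fa0.
rewrite (ae_eq_integral (cst 0%E)) ?integral0//.
- by apply/measurable_EFinP; exact: measurable_unitL1.
- by apply: filterS (unitL1_zeroE mu) => x e _; rewrite e.
Qed.
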